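(* Let $\mathfrak{A}$ be a dual Banach algebra. Then the following are equivalent: (i) $\mathfrak{A}$ is Connes-amenable. (ii) There is a $\sigma\mathrm{WC}$-virtual diagonal for $\mathfrak{A}$.
   Context: Dual Banach algebra: a Banach algebra $\mathfrak{A}$ which is the dual of a (fixed) Banach space $\mathfrak{A}_\ast$ such that multiplication is separately $\sigma(\mathfrak{A},\mathfrak{A}_\ast)$-continuous ($w^\ast$-topology). $\mathfrak{A}_\ast$ is then a closed sub-bimodule of $\mathfrak{A}^\ast$. Dual bimodule actions: $\langle x,a\cdot\phi\rangle=\langle x\cdot a,\phi\rangle$, $\langle x,\phi\cdot a\rangle=\langle a\cdot x,\phi\rangle$. A dual Banach $\mathfrak{A}$-bimodule is a Banach $\mathfrak{A}$-bimodule $E$ that is the dual of a Banach space $E_\ast$ such that $x\mapsto a\cdot x$ and $x\mapsto x\cdot a$ are $\sigma(E,E_\ast)$-continuous for each $a\in\mathfrak{A}$. It is normal if for every $x\in E$ the maps $a\mapsto a\cdot x$, $a\mapsto x\cdot a$ from $\mathfrak{A}$ to $E$ are $w^\ast$-continuous. A derivation $D:\mathfrak{A}\to E$ is a bounded linear map with $D(ab)=a\cdot Db+(Da)\cdot b$; it is inner if there is $x\in E$ with $Da=a\cdot x-x\cdot a$ for all $a\in\mathfrak{A}$. $\mathfrak{A}$ is Connes-amenable if every $w^\ast$-continuous derivation from $\mathfrak{A}$ into a normal, dual Banach $\mathfrak{A}$-bimodule is inner. For a Banach $\mathfrak{A}$-bimodule $E$, $\sigma\mathrm{WC}(E)$ is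 the set of all $x\in E$ such that the maps $a\mapsto a\cdot x$ and $a\mapsto x\cdot a$ from $\mathfrak{A}$ to $E$ are $\sigma(\mathfrak{A},\mathfrak{A}_\ast)$-$\sigma(E,E^\ast)$-continuous; it is a closed submodule of $E$. $\mathfrak{A}\hat{\otimes}\mathfrak{A}$ (projective tensor product) is a Banach $\mathfrak{A}$-bimodule via $a\cdot(x\otimes y)=ax\otimes y$, $(x\otimes y)\cdot a=x\otimes ya$; $\Delta:\mathfrak{A}\hat{\otimes}\mathfrak{A}\to\mathfrak{A}$, $a\otimes b\mapsto ab$, is the multiplication map. Its adjoint $\Delta^\ast$ maps $\mathfrak{A}_\ast$ into $\sigma\mathrm{WC}((\mathfrak{A}\hat{\otimes}\mathfrak{A})^\ast)$; let $\Delta_{\sigma\mathrm{WC}}:\sigma\mathrm{WC}((\mathfrak{A}\hat{\otimes}\mathfrak{A})^\ast)^\ast\to\mathfrak{A}$ be the adjoint of $\Delta^\ast|_{\mathfrak{A}_\ast}:\mathfrak{A}_\ast\to\sigma\mathrm{WC}((\mathfrak{A}\hat{\otimes}\mathfrak{A})^\ast)$. A $\sigma\mathrm{WC}$-virtual diagonal for $\mathfrak{A}$ is an element $\mathrm{M}\in\sigma\mathrm{WC}((\mathfrak{A}\hat{\otimes}\mathfrak{A})^\ast)^\ast$ such that $a\cdot\mathrm{M}=\mathrm{M}\cdot a$ and $a\,\Delta_{\sigma\mathrm{WC}}\mathrm{M}=a$ for all $a\in\mathfrak{A}$. *)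

(* Defs.v *)
From HB Require Import structures.
From mathcomp Require Import all_boot all_order all_algebra complex.
From mathcomp Require Import all_classical all_reals topology normedtype.
Set Implicit Arguments. Unset Strict Implicit. Unset Printing Implicit Defensive.
Import Order.TTheory GRing.Theory Num.Theory.
Import numFieldNormedType.Exports.
Local Open Scope classical_set_scope.
Local Open Scope ring_scope.
Local Open Scope complex_scope.

(* The complex field. Naming it keeps the canonical instances of normed       *)
(* modules over it stable under simplification.                               *)
Definition Cx (R : realType) : numClosedFieldType := R[i].
Arguments Cx : simpl never.

Definition ofR (R : realType) (r : R) : Cx R := r%:C.
Definition toR (R : realType) (z : Cx R) : R := complex.Re z.
Arguments ofR : simpl never.
Arguments toR : simpl never.

Lemma toRK (R : realType) (z : Cx R) : 0 <= z -> ofR (toR z) = z.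
Proof. by move=> z0; apply: RRe_real; exact: ger0_real. Qed.

Lemma ofR_le (R : realType) (r s : R) : (ofR r <= ofR s) = (r <= s).
Proof. exact: lecR. Qed.

Section BoundedMap.
Variables (R : realType) (U V : normedModType (Cx R)).

Definition bounded_linear : {pred U -> V} := fun f =>
  `[< linear f /\ exists k : Cx R, forall x, `|f x| <= k * `|x| >].

Lemma bounded_linear_submod : submod_closed bounded_linear.
Proof.
split.
- apply/asboolP; split; first by move=> a x y /=; rewrite scaler0 addr0.
  by exists 0 => x; rewrite normr0 mul0r.
- move=> a f g /asboolP[lf [k fk]] /asboolP[lg [m gm]]; apply/asboolP; split.
    move=> b x y; rewrite -[LHS]/(a *: f (b *: x + y) + g (b *: x + y)).
    rewrite lf lg -[RHS]/(b *: (a *: f x + g x) + (a *: f y + g y)).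
    by rewrite !scalerDr !scalerA (mulrC b) addrACA.
  exists (`|a| * k + m) => x; rewrite -[X in `|X|]/(a *: f x + g x) (le_trans (ler_normD _ _))//.
  by rewrite mulrDl lerD// normrZ -mulrA ler_wpM2l.
Qed.
HB.instance Definition _ :=
  GRing.isSubmodClosed.Build _ _ bounded_linear bounded_linear_submod.

(* The space B(U, V) of bounded linear maps, with the operator norm. *)
Record bmap := BMap { bmap_fun :> U -> V; _ : bmap_fun \in bounded_linear }.
HB.instance Definition _ := [isSub for bmap_fun].
HB.instance Definition _ := [Choice of bmap by <:].
HB.instance Definition _ := [SubChoice_isSubLmodule of bmap by <:].

Lemma bmap_linear (f : bmap) : linear f.
Proof. by have /asboolP[] := valP f. Qed.

Lemma bmap_bounded (f : bmap) : exists k : Cx R, forall x, `|f x| <= k * `|x|.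
Proof. by have /asboolP[] := valP f. Qed.

HB.instance Definition _ (f : bmap) :=
  GRing.isLinear.Build (Cx R) U V *:%R f (bmap_linear f).

Lemma bmapD (f g : bmap) x : (f + g) x = f x + g x. Proof. by []. Qed.
Lemma bmapZ a (f : bmap) x : (a *: f) x = a *: f x. Proof. by []. Qed.
Lemma bmap_ext (f g : bmap) : f =1 g -> f = g.
Proof. by move=> fg; apply/val_inj/funext. Qed.

Definition opnorm (f : bmap) : Cx R :=
  ofR (sup [set toR `|f x| | x in [set x : U | `|x| <= 1]]).

Let ball_bound (f : bmap) : has_sup [set toR `|f x| | x in [set x : U | `|x| <= 1]].
Proof.
split; first by exists (toR `|f 0|), 0 => //=; rewrite normr0.
have [k fk] := bmap_bounded f; exists (toR `|k|) => _ [x /= x1 <-].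
rewrite -ofR_le !toRK// (le_trans (fk x))//.
have [->|x0] := eqVneq x 0; first by rewrite normr0 mulr0 normr_ge0.
have k0 : 0 <= k.
  by have := le_trans (normr_ge0 _) (fk x); rewrite pmulr_lge0// normr_gt0.
by rewrite ger0_norm// ler_piMr.
Qed.

Lemma opnorm_ge0 f : 0 <= opnorm f.
Proof.
rewrite /opnorm -[0]/(ofR 0) ofR_le.
apply: (le_trans _ (ub_le_sup (ball_bound f).2 _)); last first.
  by exists 0 => //=; rewrite normr0.
by rewrite linear0 normr0.
Qed.

Lemma le_opnorm (f : bmap) x : `|f x| <= opnorm f * `|x|.
Proof.
have [->|x0] := eqVneq x 0; first by rewrite linear0 !normr0 mulr0.
have nx : 0 < `|x| by rewrite normr_gt0.
have := ub_le_sup (ball_bound f).2 (x := toR `|f (`|x|^-1 *: x)|).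
rewrite -ofR_le toRK// => h.
rewrite -ler_pdivrMr//; apply: le_trans (h _); last first.
  by exists (`|x|^-1 *: x) => //=; rewrite normrZ normfV normr_id mulVf ?gt_eqF.
by rewrite linearZ /= normrZ normfV normr_id mulrC.
Qed.

Lemma opnorm_le (f : bmap) k :
  0 <= k -> (forall x, `|f x| <= k * `|x|) -> opnorm f <= k.
Proof.
move=> k0 fk; rewrite -(toRK k0) ofR_le; apply: ge_sup.
  exact: (ball_bound f).1.
move=> _ [x /= x1 <-]; rewrite -ofR_le !toRK//.
by rewrite (le_trans (fk x))// ler_piMr.
Qed.

Let opnormD f g : opnorm (f + g) <= opnorm f + opnorm g.
Proof.
apply: opnorm_le => [|x]; first by rewrite addr_ge0 ?opnorm_ge0.
by rewrite bmapD (le_trans (ler_normD _ _))// mulrDl lerD ?le_opnorm.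
Qed.

Let opnormZle a f : opnorm (a *: f) <= `|a| * opnorm f.
Proof.
apply: opnorm_le => [|x]; first by rewrite mulr_ge0 ?opnorm_ge0.
by rewrite bmapZ normrZ -mulrA ler_wpM2l ?le_opnorm.
Qed.

Let opnormZ a f : opnorm (a *: f) = `|a| * opnorm f.
Proof.
apply/eqP; rewrite eq_le opnormZle /=.
have [->|a0] := eqVneq a 0; first by rewrite normr0 mul0r opnorm_ge0.
have := opnormZle a^-1 (a *: f).
by rewrite scalerA mulVf// scale1r normfV ler_pdivlMl ?normr_gt0.
Qed.

Let opnorm0_eq0 f : opnorm f = 0 -> f = 0.
Proof.
move=> f0; apply: bmap_ext => x; apply/normr0_eq0/eqP.
by rewrite eq_le normr_ge0 andbT (le_trans (le_opnorm f x))// f0 mul0r.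
Qed.

HB.instance Definition _ := Lmodule_isNormed.Build (Cx R) bmap
  opnormD opnormZ opnorm0_eq0.
End BoundedMap.
Arguments bounded_linear {R} U V.

Section BMapConstructions.
Variable R : realType.
Implicit Types U V W : normedModType (Cx R).

Lemma mk_bmap_subproof U V (f : U -> V) : linear f ->
  (exists k : Cx R, forall x, `|f x| <= k * `|x|) -> f \in bounded_linear U V.
Proof. by move=> fl fb; apply/asboolP. Qed.

Definition mk_bmap U V (f : U -> V) (fl : linear f)
    (fb : exists k : Cx R, forall x, `|f x| <= k * `|x|) : bmap U V :=
  BMap (mk_bmap_subproof fl fb).

Lemma bmap_comp_linear U V W (g : bmap V W) (f : bmap U V) : linear (g \o f).
Proof. by move=> a x y; rewrite /= (bmap_linear f) (bmap_linear g). Qed.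

Lemma bmap_comp_bounded U V W (g : bmap V W) (f : bmap U V) :
  exists k : Cx R, forall x, `|(g \o f) x| <= k * `|x|.
Proof.
exists (`|g| * `|f|) => x /=; rewrite (le_trans (le_opnorm g (f x)))//.
by rewrite -mulrA ler_wpM2l ?opnorm_ge0 ?le_opnorm.
Qed.

Definition bmap_comp U V W (g : bmap V W) (f : bmap U V) : bmap U W :=
  mk_bmap (bmap_comp_linear g f) (bmap_comp_bounded g f).

Definition dual U := bmap U (Cx R)^o.

Lemma adjoint_linear U V (f : bmap U V) :
  linear (fun phi : dual V => bmap_comp phi f : dual U).
Proof. by move=> a phi psi; apply: bmap_ext. Qed.

Lemma adjoint_bounded U V (f : bmap U V) : exists k : Cx R,
  forall phi : dual V, `|bmap_comp phi f : dual U| <= k * `|phi|.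
Proof.
exists `|f| => phi; apply: opnorm_le => [|x]; first by rewrite mulr_ge0.
rewrite (le_trans (le_opnorm phi _))// [leRHS]mulrAC mulrC ler_wpM2r ?opnorm_ge0//.
exact: le_opnorm.
Qed.

Definition adjoint U V (f : bmap U V) : bmap (dual V) (dual U) :=
  mk_bmap (adjoint_linear f) (adjoint_bounded f).

Definition bilinear_map U V W (f : U -> V -> W) :=
  (forall v, linear (f ^~ v)) /\ (forall u, linear (f u)).

(* sigma(E, F) for a pairing b between E and F: the coarsest topology on E   *)
(* making every b(-, y) continuous.                                          *)
Definition sigma (E F : choiceType) (b : E -> F -> Cx R) :
    topologicalType :=
  initial_topology (b : E -> {ptws F -> (Cx R)^o}).

Definition sigma_continuous (E F E' F' : choiceType)
    (b : E -> F -> Cx R) (b' : E' -> F' -> Cx R) (f : E -> E') :=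
  continuous (f : sigma b -> sigma b').

Definition weak_pairing U (x : U) (phi : dual U) : Cx R := phi x.

End BMapConstructions.
Arguments weak_pairing {R} U x phi.

Section SigmaTheory.
Variable R : realType.

Lemma sigma_evalc (E F : choiceType) (b : E -> F -> Cx R) y :
  continuous (fun x : sigma b => b x y : (Cx R)^o).
Proof.
move=> x.
apply: (@continuous_comp _ _ _ (b : sigma b -> {ptws F -> (Cx R)^o})
  (fun h : {ptws F -> (Cx R)^o} => h y)).
  exact: initial_continuous.
exact: (@proj_continuous F (fun=> (Cx R)^o) y).
Qed.

Lemma cvg_sigma (E F : choiceType) (b : E -> F -> Cx R) (G : set_system E)
    (FG : Filter G) (x : E) :
  (forall y, (fun z => b z y : (Cx R)^o) @ G --> (b x y : (Cx R)^o)) ->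
  G --> (x : sigma b).
Proof.
move=> Gx A [_ /= [[U oU <-]]] /= Ux UA.
have bG : (b : E -> {ptws F -> (Cx R)^o}) @ G --> (b x : {ptws F -> (Cx R)^o}).
  apply/cvg_sup => y V [_ /= [[W oW <-]]] /= Wx WV.
  have : nbhs (b x y : (Cx R)^o) W by exact: open_nbhs_nbhs.
  by move=> /Gx GW; exact: (filterS (fun z Wz => WV (b z) Wz) GW).
have : nbhs (b x : {ptws F -> (Cx R)^o}) U by exact: open_nbhs_nbhs.
by move=> /bG GU; exact: (filterS (fun z Uz => UA z Uz) GU).
Qed.

Lemma continuous_sigma (X : topologicalType) (E F : choiceType)
    (b : E -> F -> Cx R) (f : X -> E) :
  (forall y, continuous (fun x => b (f x) y : (Cx R)^o)) ->
  continuous (f : X -> sigma b).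
Proof. by move=> fc x; apply: cvg_sigma => y; exact: fc. Qed.

End SigmaTheory.

Section Predual.
Variable R : realType.

(* E is the dual of the Banach space pre_space, through an isometric linear   *)
(* bijection of E onto dual pre_space.                                        *)
Record predual (E : normedModType (Cx R)) := Predual {
  pre_space :> completeNormedModType (Cx R);
  pre_iso : E -> dual pre_space;
  pre_linear : linear pre_iso;
  pre_isometry : forall x, `|pre_iso x| = `|x|;
  pre_surj : forall phi : dual pre_space, exists x, pre_iso x = phi }.

Variables (E : normedModType (Cx R)) (P : predual E).

Definition pairing (x : E) (phi : P) : Cx R := pre_iso P x phi.

Definition of_dual (phi : dual P) : E := projT1 (cid (pre_surj phi)).

Lemma of_dualK (phi : dual P) y : pairing (of_dual phi) y = phi y.
Proof. by rewrite /pairing (projT2 (cid (pre_surj phi))). Qed.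

Lemma pairingDl a (x y : E) phi :
  pairing (a *: x + y) phi = a * pairing x phi + pairing y phi.
Proof. by rewrite /pairing pre_linear. Qed.

Lemma pairingDr a x (phi psi : P) :
  pairing x (a *: phi + psi) = a * pairing x phi + pairing x psi.
Proof. by rewrite /pairing bmap_linear. Qed.

Lemma pairing0l phi : pairing 0 phi = 0.
Proof.
by have := pairingDl (-1) 0 0 phi; rewrite scaler0 addr0 mulN1r addNr.
Qed.

Lemma pairing_le x phi : `|pairing x phi| <= `|x| * `|phi|.
Proof. by rewrite -(pre_isometry P); exact: le_opnorm. Qed.

Let pairing_linear phi : linear (fun x : E => pairing x phi : (Cx R)^o).
Proof. by move=> a x y; rewrite pairingDl. Qed.

Let ker_span (s : seq P) : forall f : E -> (Cx R)^o, linear f ->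
  (forall x, (forall phi, phi \in s -> pairing x phi = 0) -> f x = 0) ->
  exists psi, forall x, f x = pairing x psi.
Proof.
elim: s => [|phi s IH] f fl fs.
  exists 0 => x; rewrite fs// /pairing.
  by rewrite linear0.
have [[x0 [x0s x01]]|no] := pselect (exists x0,
    (forall phi', phi' \in s -> pairing x0 phi' = 0) /\ pairing x0 phi = 1).
  have gl : linear (fun x : E => f x - f x0 * pairing x phi : (Cx R)^o).
    move=> a x y; rewrite fl pairingDl mulrDr opprD addrACA.
    by rewrite scalerBr mulrCA.
  have [x xs|psi fpsi] := IH _ gl.
    have h0 : f (- pairing x phi *: x0 + x) = 0.
      apply: fs => phi'; rewrite inE => /orP[/eqP->|phis].
        by rewrite pairingDl x01 mulr1 addNr.
      by rewrite pairingDl (x0s _ phis) (xs _ phis) addr0 mulr0.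
    by rewrite -h0 fl scaleNr addrC; congr (_ + _); apply: (congr1 -%R); exact: mulrC.
  exists (f x0 *: phi + psi) => x; rewrite pairingDr -fpsi addrC subrK //.
apply: IH => // x xs; apply: fs => phi'; rewrite inE => /orP[/eqP->|]; last exact: xs.
apply/eqP; apply: contra_notT no => x1.
exists ((pairing x phi)^-1 *: x + 0); split=> [psi psis|].
  by rewrite pairingDl (xs _ psis) mulr0 add0r pairing0l.
by rewrite pairingDl mulVf// pairing0l addr0.
Qed.

(* Weak*-continuous functionals come from the predual. *)
Lemma wstar_functional (f : E -> (Cx R)^o) : linear f ->
  continuous (f : sigma pairing -> (Cx R)^o) ->
  exists psi, forall x, f x = pairing x psi.
Proof.
move=> fl fc.
pose B (s : seq P) := [set x : E | forall phi, phi \in s -> `|pairing x phi| < 1].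
pose G := filter_from setT B.
have GF : Filter G.
  apply: filter_from_filter; first by exists [::].
  move=> s t _ _; exists (s ++ t) => // x h; split => phi phis; apply: h.
    by rewrite mem_cat phis.
  by rewrite mem_cat phis orbT.
have G0 : G --> (0 : sigma pairing).
  apply: cvg_sigma => phi; apply/cvgrPdist_lt => e e0.
  exists [:: e^-1 *: phi + 0] => // x /(_ (e^-1 *: phi + 0)).
  rewrite inE eqxx => /(_ isT) xe /=; rewrite pairing0l sub0r normrN.
  move: xe; rewrite pairingDr [pairing x 0]linear0 addr0 normrM normfV.
  by rewrite (gtr0_norm e0) mulrC ltr_pdivrMr// mul1r.
have f0 : f 0 = 0.
  by have := fl (-1) 0 0; rewrite scaler0 addr0 scaleN1r addNr.
have /cvgrPdist_lt/(_ 1 ltr01) : f @ G --> f 0.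
  by apply: cvg_trans (fc 0); exact: cvg_app.
move=> -[s _ Bf]; apply: (@ker_span s) => // x xs.
apply/normr0_eq0/eqP; rewrite -[_ == _]negbK; apply/negP => nx.
have nx0 : 0 < `|f x| by rewrite lt_def nx normr_ge0.
have /Bf /= : B s (`|f x|^-1 *: x + 0).
  by move=> phi /= phis; rewrite pairingDl (xs _ phis) mulr0 add0r pairing0l normr0.
rewrite fl f0 addr0 sub0r normrN normrZ normfV normr_id mulVf ?gt_eqF//.
by rewrite ltxx.
Qed.

Lemma pre_embed_subproof phi :
  exists k : Cx R, forall x : E, `|pairing x phi : (Cx R)^o| <= k * `|x|.
Proof. by exists `|phi| => x; rewrite mulrC pairing_le. Qed.

Let embed phi : dual E := mk_bmap (@pairing_linear phi) (pre_embed_subproof phi).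

Let embed_linear : linear embed.
Proof. by move=> a phi psi; apply: bmap_ext => x; exact: pairingDr. Qed.

Let embed_bounded : exists k : Cx R, forall phi, `|embed phi| <= k * `|phi|.
Proof.
exists 1 => phi; rewrite mul1r; apply: opnorm_le => // x.
by rewrite mulrC pairing_le.
Qed.

(* The canonical embedding of E_* into E^*. *)
Definition pre_embed : bmap P (dual E) := mk_bmap embed_linear embed_bounded.

End Predual.
Arguments pairing {R E} P x phi.

Section Algebras.
Variable R : realType.

(* Not necessarily unital, hence not built on MathComp's ring structures. *)
Record banachAlg := BanachAlg {
  ba_space :> completeNormedModType (Cx R);
  ba_mul : ba_space -> ba_space -> ba_space;
  ba_bilinear : bilinear_map ba_mul;
  ba_assoc : associative ba_mul;
  ba_norm : forall a b, `|ba_mul a b| <= `|a| * `|b| }.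

Record bimodule (A : banachAlg) (E : normedModType (Cx R)) := Bimodule {
  lact : A -> E -> E;
  ract : E -> A -> E;
  lact_bilinear : bilinear_map lact;
  ract_bilinear : bilinear_map ract;
  lactA : forall a b x, lact a (lact b x) = lact (ba_mul a b) x;
  ractA : forall x a b, ract (ract x a) b = ract x (ba_mul a b);
  lractA : forall a x b, ract (lact a x) b = lact a (ract x b);
  act_bounded : exists2 k : Cx R, 0 <= k & forall a x,
    `|lact a x| <= k * `|a| * `|x| /\ `|ract x a| <= k * `|x| * `|a| }.

Record dualBanachAlg := DualBanachAlg {
  dba_alg :> banachAlg;
  dba_pre : predual dba_alg;
  dba_mul_wcontl : forall a,
    sigma_continuous (pairing dba_pre) (pairing dba_pre) (ba_mul a);
  dba_mul_wcontr : forall a,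
    sigma_continuous (pairing dba_pre) (pairing dba_pre)
      (fun b => ba_mul b a) }.

End Algebras.
Arguments bimodule {R} A E.

Section DualBimodule.
Variables (R : realType) (A : banachAlg R) (E : normedModType (Cx R)).
Variable M : bimodule A E.

Let lactb_bounded a : exists k : Cx R, forall x, `|lact M a x| <= k * `|x|.
Proof. by have [k _ kP] := act_bounded M; exists (k * `|a|) => x; case: (kP a x). Qed.

Let ractb_bounded a : exists k : Cx R, forall x, `|ract M x a| <= k * `|x|.
Proof.
have [k _ kP] := act_bounded M; exists (k * `|a|) => x.
by rewrite mulrAC; case: (kP a x).
Qed.

Definition lactb a : bmap E E := mk_bmap ((lact_bilinear M).2 a) (lactb_bounded a).
Definition ractb a : bmap E E := mk_bmap ((ract_bilinear M).1 a) (ractb_bounded a).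

(* <x, a . phi> = <x . a, phi> and <x, phi . a> = <a . x, phi> *)
Definition dual_lact (a : A) (phi : dual E) : dual E := adjoint (ractb a) phi.
Definition dual_ract (phi : dual E) (a : A) : dual E := adjoint (lactb a) phi.

Let dual_lact_bilinear : bilinear_map dual_lact.
Proof.
split=> [phi c a b|a c phi psi]; apply: bmap_ext => x //=.
by rewrite (ract_bilinear M).2 (bmap_linear phi).
Qed.

Let dual_ract_bilinear : bilinear_map dual_ract.
Proof.
split=> [a c phi psi|phi c a b]; apply: bmap_ext => x //=.
by rewrite (lact_bilinear M).1 (bmap_linear phi).
Qed.

Let dual_lactA a b phi :
  dual_lact a (dual_lact b phi) = dual_lact (ba_mul a b) phi.
Proof. by apply: bmap_ext => x /=; rewrite ractA. Qed.

Let dual_ractA phi a b :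
  dual_ract (dual_ract phi a) b = dual_ract phi (ba_mul a b).
Proof. by apply: bmap_ext => x /=; rewrite lactA. Qed.

Let dual_lractA a phi b :
  dual_ract (dual_lact a phi) b = dual_lact a (dual_ract phi b).
Proof. by apply: bmap_ext => x /=; rewrite lractA. Qed.

Let dual_act_bounded : exists2 k : Cx R, 0 <= k & forall a phi,
  `|dual_lact a phi| <= k * `|a| * `|phi| /\
  `|dual_ract phi a| <= k * `|phi| * `|a|.
Proof.
have [k k0 kP] := act_bounded M; exists k => // a phi.
split; apply: opnorm_le => [|x]; rewrite ?mulr_ge0//.
- apply: (le_trans (le_opnorm phi _)); rewrite -[opnorm phi]/(`|phi|).
  apply: (le_trans (ler_wpM2l (normr_ge0 phi) (kP a x).2)).
  by rewrite mulrC (mulrAC k) (mulrAC _ `|x|).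
- apply: (le_trans (le_opnorm phi _)); rewrite -[opnorm phi]/(`|phi|).
  apply: (le_trans (ler_wpM2l (normr_ge0 phi) (kP a x).1)).
  by rewrite mulrC (mulrAC _ `|x|) (mulrAC k).
Qed.

Definition dual_bimodule : bimodule A (dual E) :=
  Bimodule dual_lact_bilinear dual_ract_bilinear dual_lactA dual_ractA
    dual_lractA dual_act_bounded.
End DualBimodule.

Section ConnesAmenable.
Variables (R : realType) (A : dualBanachAlg R).

Definition dual_module (E : normedModType (Cx R)) (P : predual E)
    (M : bimodule A E) :=
  forall a, sigma_continuous (pairing P) (pairing P) (lact M a) /\
            sigma_continuous (pairing P) (pairing P) (fun x => ract M x a).

Definition normal_module (E : normedModType (Cx R)) (P : predual E)
    (M : bimodule A E) :=
  forall x, sigma_continuous (pairing (dba_pre A)) (pairing P) (fun a => lact M a x) /\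
            sigma_continuous (pairing (dba_pre A)) (pairing P) (ract M x).

Definition derivation (E : normedModType (Cx R)) (M : bimodule A E)
    (D : bmap A E) :=
  forall a b, D (ba_mul a b) = lact M a (D b) + ract M (D a) b.

Definition inner (E : normedModType (Cx R)) (M : bimodule A E)
    (D : bmap A E) :=
  exists x, forall a, D a = lact M a x - ract M x a.

Definition Connes_amenable :=
  forall (E : completeNormedModType (Cx R)) (P : predual E)
    (M : bimodule A E), dual_module P M -> normal_module P M ->
  forall D : bmap A E, derivation M D ->
    sigma_continuous (pairing (dba_pre A)) (pairing P) D -> inner M D.
End ConnesAmenable.

Lemma continuous_lin (R : realType) (T : topologicalType)
    (f g : T -> (Cx R)^o) (c : Cx R) :
  continuous f -> continuous g ->
  continuous (fun x => c *: f x + g x : (Cx R)^o).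
Proof.
move=> fc gc x.
have h := @cvgZl_tmp _ (Cx R)^o _ (nbhs x) _ c _ _ (fc x).
exact: (@cvgD _ (Cx R)^o _ (nbhs x) _ _ _ _ _ (h (nbhs_filter x)) (gc x)).
Qed.

Section SigmaWC.
Variables (R : realType) (A : dualBanachAlg R) (E : normedModType (Cx R)).
Variable M : bimodule A E.

Definition in_sigmaWC : {pred E} := fun x =>
  `[< sigma_continuous (pairing (dba_pre A)) (weak_pairing E) (fun a => lact M a x) /\
      sigma_continuous (pairing (dba_pre A)) (weak_pairing E) (ract M x) >].


Lemma in_sigmaWCP x : x \in in_sigmaWC <->
  ((forall W : dual E, continuous
      (fun a : sigma (pairing (dba_pre A)) => W (lact M a x))) /\ 
   (forall W : dual E, continuous
      (fun a : sigma (pairing (dba_pre A)) => W (ract M x a)))).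
Proof.
split=> [/asboolP[lc rc]|[lc rc]].
  split=> W a; [move: (lc a)|move: (rc a)].
    by move=> h; apply: (continuous_comp h); exact: (@sigma_evalc _ _ _ (weak_pairing E) W).
  by move=> h; apply: (continuous_comp h); exact: (@sigma_evalc _ _ _ (weak_pairing E) W).
by apply/asboolP; split; apply: continuous_sigma => W; [exact: lc|exact: rc].
Qed.

Lemma in_sigmaWC_submod : submod_closed in_sigmaWC.
Proof.
split; first apply/in_sigmaWCP.
  split=> W.
    rewrite (_ : (fun _ => _) = fun=> 0); first exact: cst_continuous.
    by apply/funext => a; rewrite -[lact M a 0]/(lactb M a 0) !linear0.
  rewrite (_ : (fun _ => _) = fun=> 0); first exact: cst_continuous.
  by apply/funext => a; rewrite -[ract M 0 a]/(ractb M a 0) !linear0.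
move=> c x y /in_sigmaWCP[lx rx] /in_sigmaWCP[ly ry]; apply/in_sigmaWCP.
split=> W.
  have -> : (fun b : sigma (pairing (dba_pre A)) => W (lact M b (c *: x + y))) =
      (fun b => c *: W (lact M b x) + W (lact M b y)).
    by apply/funext => b; rewrite (lact_bilinear M).2 (bmap_linear W).
  exact: continuous_lin.
have -> : (fun b : sigma (pairing (dba_pre A)) => W (ract M (c *: x + y) b)) =
    (fun b => c *: W (ract M x b) + W (ract M y b)).
  by apply/funext => b; rewrite (ract_bilinear M).1 (bmap_linear W).
exact: continuous_lin.
Qed.

HB.instance Definition _ :=
  GRing.isSubmodClosed.Build _ _ in_sigmaWC in_sigmaWC_submod.

Record sigmaWC := SigmaWC { sigmaWC_val :> E; _ : sigmaWC_val \in in_sigmaWC }.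
HB.instance Definition _ := [isSub for sigmaWC_val].
HB.instance Definition _ := [Choice of sigmaWC by <:].
HB.instance Definition _ := [SubChoice_isSubLmodule of sigmaWC by <:].

Let snormD (x y : sigmaWC) : `|val (x + y)| <= `|val x| + `|val y|.
Proof. by rewrite ler_normD. Qed.
Let snormZ c (x : sigmaWC) : `|val (c *: x)| = `|c| * `|val x|.
Proof. by rewrite normrZ. Qed.
Let snorm0_eq0 (x : sigmaWC) : `|val x| = 0 -> x = 0.
Proof. by move=> /normr0_eq0 x0; apply: val_inj. Qed.
HB.instance Definition _ := Lmodule_isNormed.Build (Cx R) sigmaWC
  snormD snormZ snorm0_eq0.

End SigmaWC.

Section SigmaWCBimodule.
Variables (R : realType) (A : dualBanachAlg R) (E : normedModType (Cx R)).
Variable M : bimodule A E.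

Lemma sigmaWC_lact a x : x \in in_sigmaWC M -> lact M a x \in in_sigmaWC M.
Proof.
move=> /in_sigmaWCP[lx rx]; apply/in_sigmaWCP; split=> W b.
  under eq_fun do rewrite lactA.
  apply: (@continuous_comp _ _ _ (fun b : sigma (pairing (dba_pre A)) =>
    ba_mul b a : sigma (pairing (dba_pre A))) (fun c => W (lact M c x))).
    exact: dba_mul_wcontr.
  exact: lx.
under eq_fun do rewrite lractA.
exact: (rx (bmap_comp W (lactb M a)) b).
Qed.

Lemma sigmaWC_ract x a : x \in in_sigmaWC M -> ract M x a \in in_sigmaWC M.
Proof.
move=> /in_sigmaWCP[lx rx]; apply/in_sigmaWCP; split=> W b.
  under eq_fun do rewrite -lractA.
  exact: (lx (bmap_comp W (ractb M a)) b).
under eq_fun do rewrite ractA.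
apply: (@continuous_comp _ _ _ (fun b : sigma (pairing (dba_pre A)) =>
  ba_mul a b : sigma (pairing (dba_pre A))) (fun c => W (ract M x c))).
  exact: dba_mul_wcontl.
exact: rx.
Qed.

Let slact (a : A) (x : sigmaWC M) : sigmaWC M :=
  SigmaWC (sigmaWC_lact a (valP x)).
Let sract (x : sigmaWC M) (a : A) : sigmaWC M :=
  SigmaWC (sigmaWC_ract a (valP x)).

Let slact_bilinear : bilinear_map slact.
Proof.
split=> [x c a b|a c x y]; apply: val_inj => /=.
  exact: (lact_bilinear M).1.
exact: (lact_bilinear M).2.
Qed.

Let sract_bilinear : bilinear_map sract.
Proof.
split=> [a c x y|x c a b]; apply: val_inj => /=.
  exact: (ract_bilinear M).1.
exact: (ract_bilinear M).2.
Qed.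

Let slactA a b x : slact a (slact b x) = slact (ba_mul a b) x.
Proof. by apply: val_inj => /=; rewrite lactA. Qed.

Let sractA x a b : sract (sract x a) b = sract x (ba_mul a b).
Proof. by apply: val_inj => /=; rewrite ractA. Qed.

Let slractA a x b : sract (slact a x) b = slact a (sract x b).
Proof. by apply: val_inj => /=; rewrite lractA. Qed.

Let sact_bounded : exists2 k : Cx R, 0 <= k & forall a x,
  `|slact a x| <= k * `|a| * `|x| /\ `|sract x a| <= k * `|x| * `|a|.
Proof. by have [k k0 kP] := act_bounded M; exists k => // a x; exact: kP. Qed.

Definition sigmaWC_bimodule : bimodule A (sigmaWC M) :=
  Bimodule slact_bilinear sract_bilinear slactA sractA slractA sact_bounded.

End SigmaWCBimodule.

Section ProjectiveTensor.
Variable R : realType.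

(* A projective tensor product of E and F: a Banach space with a contractive  *)
(* bilinear map that is universal for bounded bilinear maps into Banach       *)
(* spaces, with control of the norm. This determines it up to a unique        *)
(* isometric isomorphism compatible with elementary tensors.                  *)
Record projTensor (E F : normedModType (Cx R)) := ProjTensor {
  pt_space :> completeNormedModType (Cx R);
  pt_tensor : E -> F -> pt_space;
  pt_bilinear : bilinear_map pt_tensor;
  pt_norm : forall x y, `|pt_tensor x y| <= `|x| * `|y|;
  pt_universal : forall (G : completeNormedModType (Cx R)) (f : E -> F -> G)
      (k : Cx R),
    bilinear_map f -> 0 <= k ->
    (forall x y, `|f x y| <= k * `|x| * `|y|) ->
    exists g : bmap pt_space G,
      [/\ forall x y, g (pt_tensor x y) = f x y, `|g| <= k &
          forall h : bmap pt_space G,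
            (forall x y, h (pt_tensor x y) = f x y) -> h = g] }.

Variables (E F : normedModType (Cx R)) (T : projTensor E F).

Section Lift.
Variables (G : completeNormedModType (Cx R)) (f : E -> F -> G) (k : Cx R).
Hypotheses (fl : bilinear_map f) (k0 : 0 <= k).
Hypothesis fk : forall x y, `|f x y| <= k * `|x| * `|y|.

(* The bounded linear map x (x) y |-> f x y on the projective tensor product. *)
Definition pt_lift : bmap T G :=
  projT1 (cid (pt_universal T fl k0 fk)).

Lemma pt_liftE x y : pt_lift (pt_tensor T x y) = f x y.
Proof. by have [] := projT2 (cid (pt_universal T fl k0 fk)). Qed.

Lemma pt_lift_le : `|pt_lift| <= k.
Proof. by have [] := projT2 (cid (pt_universal T fl k0 fk)). Qed.

End Lift.

Lemma pt_ext (G : completeNormedModType (Cx R)) (g h : bmap T G) :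
  (forall x y, g (pt_tensor T x y) = h (pt_tensor T x y)) -> g = h.
Proof.
move=> gh; pose f x y := h (pt_tensor T x y).
have fl : bilinear_map f.
  split=> [y c x x'|x c y y']; rewrite /f.
    by rewrite (pt_bilinear T).1 bmap_linear.
  by rewrite (pt_bilinear T).2 bmap_linear.
have fk x y : `|f x y| <= `|h| * `|x| * `|y|.
  by rewrite (le_trans (le_opnorm h _))// -mulrA ler_wpM2l ?opnorm_ge0//; exact: pt_norm.
have [u [_ _ uniq]] := pt_universal T fl (normr_ge0 h) fk.
by rewrite (uniq g gh) (uniq h (fun _ _ => erefl)).
Qed.

End ProjectiveTensor.

Section TensorSquare.
Variables (R : realType) (A : banachAlg R) (T : projTensor A A).

Let lt a x y := pt_tensor T (ba_mul a x) y.
Let rt a x y := pt_tensor T x (ba_mul y a).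

Let lt_bilinear a : bilinear_map (lt a).
Proof.
split=> [y c x x'|x c y y']; rewrite /lt.
  by rewrite (ba_bilinear A).2 (pt_bilinear T).1.
by rewrite (pt_bilinear T).2.
Qed.

Let rt_bilinear a : bilinear_map (rt a).
Proof.
split=> [y c x x'|x c y y']; rewrite /rt.
  by rewrite (pt_bilinear T).1.
by rewrite (ba_bilinear A).1 (pt_bilinear T).2.
Qed.

Let lt_le a x y : `|lt a x y| <= `|a| * `|x| * `|y|.
Proof. by rewrite (le_trans (pt_norm T _ _))// ler_wpM2r// ba_norm. Qed.

Let rt_le a x y : `|rt a x y| <= `|a| * `|x| * `|y|.
Proof.
by rewrite (le_trans (pt_norm T _ _))// -mulrA mulrCA ler_wpM2l// mulrC ba_norm.
Qed.

(* a . (x (x) y) = ax (x) y and (x (x) y) . a = x (x) ya *)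
Definition tensor_lact (a : A) : bmap T T :=
  pt_lift T (lt_bilinear a) (normr_ge0 a) (lt_le a).
Definition tensor_ract (a : A) : bmap T T :=
  pt_lift T (rt_bilinear a) (normr_ge0 a) (rt_le a).

Lemma tensor_lactE a x y : tensor_lact a (pt_tensor T x y) = pt_tensor T (ba_mul a x) y.
Proof. exact: pt_liftE. Qed.
Lemma tensor_ractE a x y : tensor_ract a (pt_tensor T x y) = pt_tensor T x (ba_mul y a).
Proof. exact: pt_liftE. Qed.

Let tlact_linear : linear tensor_lact.
Proof.
move=> c a b; apply: pt_ext => x y; rewrite bmapD bmapZ !tensor_lactE.
by rewrite (ba_bilinear A).1 (pt_bilinear T).1.
Qed.

Let tract_linear : linear tensor_ract.
Proof.
move=> c a b; apply: pt_ext => x y; rewrite bmapD bmapZ !tensor_ractE.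
by rewrite (ba_bilinear A).2 (pt_bilinear T).2.
Qed.

Let tlact_bilinear : bilinear_map (fun a t => tensor_lact a t).
Proof.
split=> [t c a b|a]; last exact: bmap_linear.
by rewrite tlact_linear bmapD bmapZ.
Qed.

Let tract_bilinear : bilinear_map (fun t a => tensor_ract a t).
Proof.
split=> [a|t c a b]; first exact: bmap_linear.
by rewrite tract_linear bmapD bmapZ.
Qed.

Let tlactA a b t : tensor_lact a (tensor_lact b t) = tensor_lact (ba_mul a b) t.
Proof.
suff -> : tensor_lact (ba_mul a b) = bmap_comp (tensor_lact a) (tensor_lact b) by [].
by apply: pt_ext => x y /=; rewrite !tensor_lactE ba_assoc.
Qed.

Let tractA t a b : tensor_ract b (tensor_ract a t) = tensor_ract (ba_mul a b) t.
Proof.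
suff -> : tensor_ract (ba_mul a b) = bmap_comp (tensor_ract b) (tensor_ract a) by [].
by apply: pt_ext => x y /=; rewrite !tensor_ractE ba_assoc.
Qed.

Let tlractA a t b : tensor_ract b (tensor_lact a t) = tensor_lact a (tensor_ract b t).
Proof.
suff : bmap_comp (tensor_ract b) (tensor_lact a) =
    bmap_comp (tensor_lact a) (tensor_ract b).
  by move=> /(congr1 (fun h : bmap T T => h t)).
by apply: pt_ext => x y /=; rewrite tensor_lactE !tensor_ractE tensor_lactE.
Qed.

Let tact_bounded : exists2 k : Cx R, 0 <= k & forall a t,
  `|tensor_lact a t| <= k * `|a| * `|t| /\
  `|tensor_ract a t| <= k * `|t| * `|a|.
Proof.
exists 1 => // a t; rewrite !mul1r; split.
  by rewrite (le_trans (le_opnorm _ _))// ler_wpM2r//; exact: pt_lift_le.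
rewrite (le_trans (le_opnorm _ _))// mulrC ler_wpM2l//; exact: pt_lift_le.
Qed.

Definition tensor_bimodule : bimodule A T :=
  Bimodule tlact_bilinear tract_bilinear tlactA tractA tlractA tact_bounded.

Let mul_le (a b : A) : `|ba_mul a b| <= 1 * `|a| * `|b|.
Proof. by rewrite mul1r ba_norm. Qed.

(* Delta (a (x) b) = ab *)
Definition Delta : bmap T A := pt_lift T (ba_bilinear A) ler01 mul_le.

Lemma DeltaE a b : Delta (pt_tensor T a b) = ba_mul a b.
Proof. exact: pt_liftE. Qed.

End TensorSquare.

Section RegularBimodule.
Variables (R : realType) (A : banachAlg R).

Let act_bounded : exists2 k : Cx R, 0 <= k & forall a x : A,
  `|ba_mul a x| <= k * `|a| * `|x| /\ `|ba_mul x a| <= k * `|x| * `|a|.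
Proof. by exists 1 => // a x; rewrite !mul1r; split; exact: ba_norm. Qed.

Definition regular_bimodule : bimodule A A :=
  Bimodule (ba_bilinear A) (ba_bilinear A) (@ba_assoc _ A)
    (fun x a b => esym (@ba_assoc _ A x a b))
    (fun a x b => esym (@ba_assoc _ A a x b)) act_bounded.

End RegularBimodule.

Section VirtualDiagonal.
Variables (R : realType) (A : dualBanachAlg R) (T : projTensor A A).

Let P := dba_pre A.
Let TM := tensor_bimodule T.
Let A_M := regular_bimodule A.

Let Delta_lact a t : Delta T (lact TM a t) = ba_mul a (Delta T t).
Proof.
suff : bmap_comp (Delta T) (tensor_lact T a) =
    bmap_comp (lactb A_M a) (Delta T).
  by move=> /(congr1 (fun h : bmap T A => h t)).
by apply: pt_ext => x y /=; rewrite tensor_lactE !DeltaE ba_assoc.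
Qed.

Let Delta_ract t a : Delta T (ract TM t a) = ba_mul (Delta T t) a.
Proof.
suff : bmap_comp (Delta T) (tensor_ract T a) =
    bmap_comp (ractb A_M a) (Delta T).
  by move=> /(congr1 (fun h : bmap T A => h t)).
by apply: pt_ext => x y /=; rewrite tensor_ractE !DeltaE ba_assoc.
Qed.

(* A_* is a sub-bimodule of A^*. *)
Let pre_lact a (phi : P) : exists psi : P,
  dual_lact A_M a (pre_embed P phi) = pre_embed P psi.
Proof.
have [psi psiE] := @wstar_functional _ _ P (dual_lact A_M a (pre_embed P phi))
  (bmap_linear _) (fun x => continuous_comp (@dba_mul_wcontr _ A a x)
    (@sigma_evalc _ _ _ (pairing P) phi _)).
by exists psi; apply: bmap_ext.
Qed.

Let pre_ract a (phi : P) : exists psi : P,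
  dual_ract A_M (pre_embed P phi) a = pre_embed P psi.
Proof.
have [psi psiE] := @wstar_functional _ _ P (dual_ract A_M (pre_embed P phi) a)
  (bmap_linear _) (fun x => continuous_comp (@dba_mul_wcontl _ A a x)
    (@sigma_evalc _ _ _ (pairing P) phi _)).
by exists psi; apply: bmap_ext.
Qed.

Lemma Delta_adjoint_sigmaWC (phi : P) :
  adjoint (Delta T) (pre_embed P phi) \in in_sigmaWC (dual_bimodule TM).
Proof.
apply/in_sigmaWCP; split=> W.
  pose b := of_dual (bmap_comp W (bmap_comp (adjoint (Delta T)) (pre_embed P))).
  have -> : (fun a : sigma (pairing P) => W (lact (dual_bimodule TM) a
      (adjoint (Delta T) (pre_embed P phi)))) =
      (fun a => pairing P (ba_mul b a) phi).
    apply/funext => a; have [psi psiE] := pre_lact a phi.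
    rewrite -[RHS]/(dual_lact A_M a (pre_embed P phi) b) psiE.
    rewrite -[RHS]/(pairing P b psi) of_dualK.
    rewrite -[RHS]/(W (adjoint (Delta T) (pre_embed P psi))) -psiE; congr (W _).
    by apply: bmap_ext => t /=; rewrite Delta_ract.
  move=> a; apply: (@continuous_comp _ _ _ (fun a : sigma (pairing P) =>
    ba_mul b a : sigma (pairing P)) (fun c => pairing P c phi)).
    exact: dba_mul_wcontl.
  exact: (@sigma_evalc _ _ _ (pairing P) phi).
pose b := of_dual (bmap_comp W (bmap_comp (adjoint (Delta T)) (pre_embed P))).
have -> : (fun a : sigma (pairing P) => W (ract (dual_bimodule TM)
    (adjoint (Delta T) (pre_embed P phi)) a)) =
    (fun a => pairing P (ba_mul a b) phi).
  apply/funext => a; have [psi psiE] := pre_ract a phi.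
  rewrite -[RHS]/(dual_ract A_M (pre_embed P phi) a b) psiE.
  rewrite -[RHS]/(pairing P b psi) of_dualK.
    rewrite -[RHS]/(W (adjoint (Delta T) (pre_embed P psi))) -psiE; congr (W _).
  by apply: bmap_ext => t /=; rewrite Delta_lact.
move=> a; apply: (@continuous_comp _ _ _ (fun a : sigma (pairing P) =>
  ba_mul a b : sigma (pairing P)) (fun c => pairing P c phi)).
  exact: dba_mul_wcontr.
exact: (@sigma_evalc _ _ _ (pairing P) phi).
Qed.

Let Dstar (phi : P) : sigmaWC (dual_bimodule TM) :=
  SigmaWC (Delta_adjoint_sigmaWC phi).

Let Dstar_linear : linear Dstar.
Proof.
move=> c x y; apply: val_inj.
exact: (bmap_linear (bmap_comp (adjoint (Delta T)) (pre_embed P)) c x y).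
Qed.

Let Dstar_bounded : exists k : Cx R, forall phi, `|Dstar phi| <= k * `|phi|.
Proof. exact: (bmap_bounded (bmap_comp (adjoint (Delta T)) (pre_embed P))). Qed.

(* The restriction of Delta^* to A_*, with values in sigmaWC. *)
Definition Delta_pre : bmap P (sigmaWC (dual_bimodule TM)) :=
  mk_bmap Dstar_linear Dstar_bounded.

(* of_dual identifies the dual of A_* with A. *)
Definition Delta_sigmaWC (M : dual (sigmaWC (dual_bimodule TM))) : A :=
  of_dual (adjoint Delta_pre M).

Definition sigmaWC_virtual_diagonal (M : dual (sigmaWC (dual_bimodule TM))) :=
  (forall a, lact (dual_bimodule (sigmaWC_bimodule (dual_bimodule TM))) a M =
             ract (dual_bimodule (sigmaWC_bimodule (dual_bimodule TM))) M a) /\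
  (forall a, ba_mul a (Delta_sigmaWC M) = a).

End VirtualDiagonal.

(* Main.v *)
Require Import Defs.
From HB Require Import structures.
From mathcomp Require Import all_boot all_order all_algebra complex.
From mathcomp Require Import all_classical all_reals topology normedtype.
Set Implicit Arguments.
Unset Strict Implicit.
Unset Printing Implicit Defensive.
Import Order.TTheory GRing.Theory Num.Theory.
Import numFieldNormedType.Exports.

(* From a virtual diagonal M to Connes-amenability: e = Delta_sigmaWC M is an
   identity of A. Given a weak*-continuous derivation D into a normal dual
   module E, each x in the predual of E defines the functional
   theta_x(a (x) b) = <a . D b, x>, which lies in sigmaWC; the element y of E
   given by <y, x> = M(theta_x) satisfies a . y - y . a = e . D a, and D is the
   inner derivation of y - (D e) . e.

   Conversely, let A be Connes-amenable. It has an identity e. The derivation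
   a |-> a (x) e - e (x) a takes its values in the kernel of Delta_sigmaWC, a
   dual module whose predual is the quotient of sigmaWC by the range of
   Delta_pre. As this range is also the range of the projection sending w to
   x (x) y |-> w(xy (x) e), the quotient can be avoided: compressing
   the actions on sigmaWC by the complementary projection p gives a module
   structure on sigmaWC itself, in whose dual the same map is a derivation. If
   it is implemented by N, then e (x) e - N o p is a virtual diagonal.
   Completeness of sigmaWC and normality of its dual rest on the Hahn-Banach
   theorem, proved by making a sublinear functional minimal with Zorn's lemma:
   a minimal sublinear functional is linear. *)

Local Open Scope classical_set_scope.
Local Open Scope ring_scope.
Local Open Scope complex_scope.

(** * Completeness of the scalars and of spaces of bounded maps *)

Section ComplexScalars.
Variable R : realType.
Implicit Types (z w : Cx R) (r s : R).

Definition iu : Cx R := 'i%C.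

Lemma toRD z w : toR (z + w) = toR z + toR w.
Proof. by case: z w => [a b] [c d]. Qed.

Lemma toRN z : toR (- z) = - toR z.
Proof. by case: z. Qed.

Lemma toRZ r z : toR (ofR r * z) = r * toR z.
Proof. by case: z => a b; rewrite /toR/= mul0r subr0. Qed.

Lemma ofRK r : toR (ofR r) = r. Proof. by []. Qed.

Lemma ofRD r s : ofR (r + s) = ofR r + ofR s.
Proof. exact: (rmorphD (real_complex R)). Qed.

Lemma ofRM r s : ofR (r * s) = ofR r * ofR s.
Proof. exact: (rmorphM (real_complex R)). Qed.

Lemma ofRN r : ofR (- r) = - ofR r.
Proof. exact: (rmorphN (real_complex R)). Qed.

Lemma ofR_ge0 r : (0 <= ofR r) = (0 <= r).
Proof. exact: (ofR_le 0). Qed.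

Lemma norm_iu : `|iu| = 1.
Proof. by rewrite normc_def /= expr0n /= add0r expr1n sqrtr1. Qed.

Lemma iuM : iu * iu = -1.
Proof. by rewrite -expr2; exact: (@sqr_i R). Qed.

(** The real part of [iu * z] is minus the imaginary part of [z]; this formula later rebuilds a
    complex-linear functional from its real part. *)
Lemma CxE z : z = ofR (toR z) - iu * ofR (toR (iu * z)).
Proof.
by case: z => a b; rewrite /ofR /toR /iu; simpc.
Qed.

Lemma toR_CxE r s : toR (ofR r - iu * ofR s) = r.
Proof. by rewrite toRD toRN mulrC toRZ [X in r - X]mulr0 subr0. Qed.

Lemma norm_toR z : `|toR z| <= toR `|z|.
Proof. by rewrite -ofR_le toRK//; exact: (@normc_ge_Re R). Qed.

Lemma toR_le z w : z <= w -> toR z <= toR w.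
Proof. by rewrite lecE => /andP[]. Qed.

Lemma toR_lt z w : z < w -> toR z < toR w.
Proof. by rewrite ltcE => /andP[]. Qed.

Lemma norm_ofR r : `|ofR r| = ofR `|r|.
Proof. by rewrite normc_def/= expr0n addr0 sqrtr_sqr. Qed.

Lemma norm_ofRB r s : `|ofR r - ofR s| = ofR `|r - s|.
Proof. by rewrite -ofRN -[_ + _]ofRD norm_ofR. Qed.

End ComplexScalars.

Section Completeness.
Variable R : realType.

(** A unimodular factor preserves distances and real parts contract them; [c] is [1] or [iu R], one
    for each coordinate. *)
Let toR_cvg (F : set_system (Cx R)^o) (f : Cx R -> Cx R) (c : Cx R) :
  ProperFilter F -> cauchy F -> f =1 *%R c -> `|c| = 1 ->
  cvg (toR (f z) @[z --> F]).
Proof.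
move=> PF /cauchyP Fc fE c1; apply: R_complete; apply: cauchy_exP => e e0.
have [|z Fz] := Fc (ofR e); first by rewrite ltcR.
exists (toR (f z)); move: Fz; apply: (@filterS _ F) => w; rewrite -!ball_normE /= => zw.
rewrite -toRN -toRD !fE -mulrN -mulrDr (le_lt_trans (norm_toR _))//.
by rewrite normrM c1 mul1r -(ofRK e); exact: toR_lt.
Qed.

Lemma Cx_complete (F : set_system (Cx R)^o) :
  ProperFilter F -> cauchy F -> cvg F.
Proof.
move=> PF Fc.
have cr : cvg (toR (id z) @[z --> F]).
  by apply: (toR_cvg PF Fc (c := 1)) => [x|]; rewrite ?mul1r ?normr1.
have ci : cvg (toR (iu R * z) @[z --> F]).
  by apply: (toR_cvg PF Fc (c := iu R)) => //; exact: norm_iu.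
apply/cvg_ex; pose l : (Cx R)^o := ofR (lim (toR (id z) @[z --> F])) -
   iu R * ofR (lim (toR (iu R * z) @[z --> F])); exists l.
apply/cvgrPdist_le => e e0.
have e20 : 0 < toR e / 2 by rewrite divr_gt0// (toR_lt e0).
have /cvgrPdist_le/(_ _ e20) hr := cr.
have /cvgrPdist_le/(_ _ e20) hi := ci.
near=> z.
rewrite (CxE z) /l opprD addrACA -opprD -mulrBr.
rewrite (le_trans (ler_normB _ _))// normrM norm_iu mul1r.
rewrite !norm_ofRB -ofRD -[e]toRK ?(ltW e0)// ofR_le.
rewrite [leRHS]splitr lerD//; near: z; [exact: hr|exact: hi].
Unshelve. all: by end_near. Qed.
End Completeness.

(** A Banach-space structure on the scalars lets the universal property of the projective tensor
    product apply to scalar-valued bilinear maps. *)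
Definition Cx_complete_normed (R : realType) : completeNormedModType (Cx R) :=
  HB.pack (Cx R)^o (Uniform_isComplete.Build (Cx R)^o (@Cx_complete R)).

Section BoundedMapCompleteness.
Variables (R : realType) (U : normedModType (Cx R)).
Variable V : completeNormedModType (Cx R).

Lemma bmap_complete (F : set_system (bmap U V)) :
  ProperFilter F -> cauchy F -> cvg F.
Proof.
move=> PF Fc0; have /cauchyP Fc := Fc0.
have near_f (e : Cx R) : 0 < e -> exists f0 : bmap U V,
    F [set f : bmap U V | forall x, `|f0 x - f x| <= e * `|x|].
  move=> e0; have [f0 Ff0] := Fc _ e0; exists f0; move: Ff0.
  apply: filterS => f; rewrite -ball_normE /= => /ltW ff0 x.
  by apply: le_trans (le_opnorm (f0 - f) x) _; rewrite ler_wpM2r.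
pose L (x : U) : V := lim ((fun f : bmap U V => f x) @ F).
have cL x : (fun f : bmap U V => f x) @ F --> L x.
  apply: cauchy_cvg; apply: cauchy_exP => e e0.
  have [|f0 Hf0] := near_f (e / (`|x| + 1)); first by rewrite divr_gt0// ltr_wpDl.
  exists (f0 x); apply: (@filterS _ F) Hf0 => f /(_ x) H; rewrite -ball_normE /=.
  rewrite (le_lt_trans H)// mulrAC ltr_pdivrMr ?ltr_wpDl//.
  by rewrite ltr_pM2l// ltrDl.
have Ll : linear L.
  move=> a x y; apply: (@cvg_lim _ (@norm_hausdorff _ V)).
  have -> : (fun f : bmap U V => f (a *: x + y)) = (fun f => a *: f x + f y).
    by apply/funext => f; rewrite bmap_linear.
  by apply: cvgD; [exact: cvgZr|exact: cL].
have near_L (e : Cx R) : 0 < e -> exists f0 : bmap U V,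
    F [set f : bmap U V | forall x, `|f0 x - f x| <= e * `|x|] /\
    forall x, `|f0 x - L x| <= e * `|x|.
  move=> e0; have [f0 Hf0] := near_f e e0; exists f0; split=> // x.
  (* At a fixed [x], a member [f] of the filter close to [L x] carries the uniform bound over to the
     limit, up to an arbitrary [d]. *)
  apply/ler_addgt0Pr => d d0.
  have /cvgrPdist_le/(_ _ d0) Hd := cL x.
  near F => f; rewrite -(subrKA (f x)) (le_trans (ler_normD _ _))// lerD//.
    by near: f; apply: filterS Hf0 => f.
  by rewrite distrC; near: f.
have Lb : exists k : Cx R, forall x, `|L x| <= k * `|x|.
  have [f0 [_ Hf0]] := near_L 1 ltr01; exists (opnorm f0 + 1) => x.
  rewrite -[L x](subKr (f0 x)) (le_trans (ler_normB _ _))// mulrDl lerD//.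
  exact: le_opnorm.
apply/cvg_ex; exists (mk_bmap Ll Lb); apply/cvgrPdist_le => e e0.
have [|f0 [Hf HL]] := near_L (e / 2); first by rewrite divr_gt0.
apply: filterS Hf => f Hf; apply: opnorm_le => [|x]; first exact: ltW.
rewrite -[leLHS]/(`|L x - f x|) -(subrKA (f0 x)) (le_trans (ler_normD _ _))//.
by rewrite distrC [e]splitr mulrDl lerD.
Unshelve. all: by end_near. Qed.

End BoundedMapCompleteness.

Definition dual_complete_normed (R : realType) (U : normedModType (Cx R)) :
    completeNormedModType (Cx R) :=
  HB.pack (bmap U (Cx R)^o) (Uniform_isComplete.Build (bmap U (Cx R)^o)
    (@bmap_complete R U (Cx_complete_normed R))).

(** * The Hahn-Banach theorem *)

Section HahnBanach.
Variables (R : realType) (X : normedModType (Cx R)).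
Implicit Types (p q : X -> R) (x : X).

Definition sublinear p :=
  (forall x y, p (x + y) <= p x + p y) /\
  (forall r x, 0 < r -> p (ofR r *: x) <= r * p x).

Lemma sublinear_ge0 p : sublinear p -> 0 <= p 0.
Proof. by move=> [pD _]; have := pD 0 0; rewrite addr0 -subr_ge0 addrK. Qed.

Lemma sublinear_geN p x : sublinear p -> - p (- x) <= p x.
Proof.
move=> sp; have := sp.1 x (- x); rewrite subrr => h.
by rewrite lerNl -subr_ge0 opprK addrC (le_trans (sublinear_ge0 sp)).
Qed.

Lemma ofRV (r : R) x : r != 0 -> ofR r^-1 *: (ofR r *: x) = x.
Proof. by move=> r0; rewrite scalerA -ofRM mulVf// scale1r. Qed.

Lemma sublinearZ p r x : sublinear p -> 0 < r -> p (ofR r *: x) = r * p x.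
Proof.
move=> sp r0; apply/eqP; rewrite eq_le sp.2//=.
by rewrite -ler_pdivlMl// -{1}[x](@ofRV r) ?gt_eqF// sp.2// invr_gt0.
Qed.

(* Lowers p to a sublinear functional whose value at -y is at most - p y. *)
Definition tilt p y x : R :=
  inf [set p (x + ofR t *: y) - t * p y | t in [set t | 0 <= t]].

(** Subadditivity for [t y = (x + t y) + (- x)]; it keeps the infimum defining [tilt] finite. *)
Lemma tilt_lb p y x t : sublinear p -> 0 <= t ->
  - p (- x) <= p (x + ofR t *: y) - t * p y.
Proof.
move=> sp t0; rewrite lerBrDr addrC lerBlDr.
have := sp.1 (x + ofR t *: y) (- x); rewrite [x + _]addrC addrK.
apply: le_trans; move: t0; rewrite le_eqVlt => /predU1P[<-|t0].
  by rewrite mul0r scale0r sublinear_ge0.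
by rewrite sublinearZ.
Qed.

Lemma tilt_has_inf p y x : sublinear p ->
  has_inf [set p (x + ofR t *: y) - t * p y | t in [set t | 0 <= t]].
Proof.
move=> sp; split; first by exists (p (x + ofR 0 *: y) - 0 * p y), 0 => /=.
by exists (- p (- x)) => _ [t t0 <-]; exact: tilt_lb.
Qed.

Lemma tilt_le p y x t : sublinear p -> 0 <= t ->
  tilt p y x <= p (x + ofR t *: y) - t * p y.
Proof.
by move=> sp t0; apply: ge_inf; [exact: (tilt_has_inf y x sp).2|exists t].
Qed.

Lemma le_tilt p y x c : sublinear p ->
  (forall t, 0 <= t -> c <= p (x + ofR t *: y) - t * p y) -> c <= tilt p y x.
Proof.
move=> sp h; apply: lb_le_inf; first exact: (tilt_has_inf y x sp).1.
by move=> _ [t t0 <-]; exact: h.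
Qed.

Lemma tilt_sublinear p y : sublinear p -> sublinear (tilt p y).
Proof.
move=> sp; split=> [x x'|r x r0].
  rewrite -lerBlDl; apply: le_tilt => // t t0.
  rewrite lerBlDl -lerBlDr; apply: le_tilt => // s s0.
  rewrite lerBlDr (le_trans (tilt_le _ _ sp (addr_ge0 s0 t0)))//.
  rewrite ofRD scalerDl addrACA mulrDl opprD addrACA [leRHS]addrACA lerD2r.
  by rewrite addrACA sp.1.
rewrite -ler_pdivrMl//; apply: le_tilt => // t t0.
rewrite ler_pdivrMl// (le_trans (tilt_le _ _ sp (mulr_ge0 (ltW r0) t0)))//.
by rewrite ofRM -scalerA -scalerDr sublinearZ// mulrBr mulrA.
Qed.

Lemma tilt_le_self p y x : sublinear p -> tilt p y x <= p x.
Proof.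
by move=> sp; have := tilt_le y x sp (lexx 0); rewrite [ofR 0 *: _]scale0r addr0 mul0r subr0.
Qed.

Lemma minimal_sublinear p : sublinear p -> exists f,
  [/\ sublinear f, forall x, f x <= p x &
    forall q, sublinear q -> (forall x, q x <= f x) -> forall x, q x = f x].
Proof.
move=> sp; pose below q := sublinear q /\ forall x, q x <= p x.
pose S := {q | below q}.
(* The order is reversed, so that a maximal element for Zorn is a minimal functional. *)
pose le_S (a b : S) := `[< forall x, sval b x <= sval a x >].
have [||||f fmin] := @Zorn S le_S.
- by move=> a; apply/asboolP.
- by move=> a b c /asboolP ab /asboolP bc; apply/asboolP => x; exact: le_trans (ab x).
- move=> [a pa] [b pb] /asboolP/= ab /asboolP/= ba; apply: eq_exist.
  by apply/funext => x; apply/eqP; rewrite eq_le ab ba.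
(* The empty chain is bounded by [p], a nonempty one by its pointwise infimum. *)
- move=> C Ctot; have [[a0 Ca0]|C0] := pselect (exists a, C a); last first.
    have pp : sublinear p /\ forall x, p x <= p x by [].
    by exists (exist below p pp) => a Ca; case: C0; exists a.
  pose V x := [set sval a x | a in C].
  have Vinf x : has_inf (V x).
    split; first by exists (sval a0 x), a0.
    exists (- p (- x)) => _ [a Ca <-].
    apply: le_trans (sublinear_geN x (svalP a).1).
    by rewrite lerN2 (svalP a).2.
  have Vle a x : C a -> inf (V x) <= sval a x.
    by move=> Ca; apply: ge_inf; [exact: (Vinf x).2|exists a].
  have Vsub : sublinear (fun x => inf (V x)).
    split=> [x y|r x r0].
      rewrite -lerBlDl; apply: lb_le_inf => [|_ [b Cb <-]]; first exact: (Vinf _).1.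
      rewrite lerBlDl -lerBlDr; apply: lb_le_inf => [|_ [a Ca <-]]; first exact: (Vinf _).1.
      rewrite lerBlDr.
      (* The smaller of the two comparable functionals serves for both [x] and [y]. *)
      have [/asboolP ab|/asboolP ba] := Ctot a b Ca Cb.
        rewrite (le_trans (Vle b _ Cb))// (le_trans ((svalP b).1.1 x y))// lerD2r.
        exact: ab.
      rewrite (le_trans (Vle a _ Ca))// (le_trans ((svalP a).1.1 x y))// lerD2l.
      exact: ba.
    rewrite -ler_pdivrMl//; apply: lb_le_inf => [|_ [a Ca <-]]; first exact: (Vinf _).1.
    by rewrite ler_pdivrMl// -(sublinearZ _ (svalP a).1)// Vle.
  have Vp x : inf (V x) <= p x by apply: le_trans (Vle a0 x Ca0) _; exact: (svalP a0).2.
  by exists (exist below _ (conj Vsub Vp)) => a Ca; apply/asboolP => x; exact: Vle.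
exists (sval f); split; [exact: (svalP f).1|exact: (svalP f).2|].
move=> q sq qf x.
have qp x' : q x' <= p x' by apply: le_trans (qf x') _; exact: (svalP f).2.
by rewrite -(fmin (exist below q (conj sq qp)))//; apply/asboolP.
Qed.

(** A minimal [f] equals its tilt in every direction [y]; the parameter 1 then gives
    [f x + f y <= f (x + y)], hence additivity. *)
Lemma real_functional p : sublinear p -> exists f : X -> R,
  [/\ forall x, f x <= p x, forall x y, f (x + y) = f x + f y &
      forall r x, f (ofR r *: x) = r * f x].
Proof.
move=> /minimal_sublinear[f [sf fp fmin]].
have fD x y : f (x + y) = f x + f y.
  apply/eqP; rewrite eq_le sf.1/=.
  rewrite -(fmin _ (tilt_sublinear y sf) (fun x => tilt_le_self y x sf) x).
  have := tilt_le y x sf ler01.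
  by rewrite [ofR 1 *: _]scale1r mul1r lerBrDr.
have f0 : f 0 = 0.
  by apply/eqP; have := fD 0 0; rewrite addr0 => /eqP; rewrite eq_sym -subr_eq0 addrK.
have fN x : f (- x) = - f x.
  by apply/eqP; rewrite -addr_eq0 -fD addNr f0.
exists f; split=> // r x; have [r0|r0|->] := ltgtP r 0.
- by rewrite -[r]opprK ofRN scaleNr fN sublinearZ ?oppr_gt0// !mulNr.
- exact: sublinearZ.
- by rewrite scale0r mul0r f0.
Qed.

(** * Extension of a dominated linear functional *)

Section Extension.
Variables (Y : normedModType (Cx R)) (j : {linear Y -> X}).
Variables (N : {linear Y -> (Cx R)^o}) (C : R).
Hypothesis C0 : 0 <= C.
Hypothesis NC : forall y, `|N y| <= ofR C * `|j y|.

Let nX x : R := toR `|x|.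

Let nXD x y : nX (x + y) <= nX x + nX y.
Proof. by rewrite /nX -toRD; apply/toR_le/ler_normD. Qed.

Let nXZ r x : 0 < r -> nX (ofR r *: x) = r * nX x.
Proof. by move=> r0; rewrite /nX normrZ norm_ofR toRZ gtr0_norm. Qed.

(* The largest sublinear functional that is at most [C * |x|] and whose
   restriction along [j] is at most the real part of [N]. *)
Let dom x : R := inf [set toR (N y) + C * nX (x - j y) | y in setT].

Let dom_has_inf x : has_inf [set toR (N y) + C * nX (x - j y) | y in setT].
Proof.
split; first by exists (toR (N 0) + C * nX (x - j 0)), 0.
exists (- (C * nX x)) => _ [y _ <-].
have h : nX (j y) <= nX x + nX (x - j y).
  by have := nXD x (- (x - j y)); rewrite opprB addrC subrK /nX (distrC (j y)).
have : - toR (N y) <= C * (nX x + nX (x - j y)).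
  apply: le_trans (ler_wpM2l C0 h).
  rewrite (le_trans (ler_norm _))// normrN (le_trans (norm_toR _))//.
  by rewrite -toRZ; apply/toR_le/NC.
rewrite mulrDr -subr_ge0 opprK -addrA [X in _ + X]addrC => {}h.
by rewrite -subr_ge0 opprK addrC.
Qed.

Let dom_le x y : dom x <= toR (N y) + C * nX (x - j y).
Proof. by apply: ge_inf; [exact: (dom_has_inf x).2|exists y]. Qed.

Let le_dom x c : (forall y, c <= toR (N y) + C * nX (x - j y)) -> c <= dom x.
Proof.
move=> h; apply: lb_le_inf; first exact: (dom_has_inf x).1.
by move=> _ [y _ <-]; exact: h.
Qed.

Let dom_sublinear : sublinear dom.
Proof.
split=> [x x'|r x r0].
  rewrite -lerBlDl; apply: le_dom => y'.
  rewrite lerBlDl -lerBlDr; apply: le_dom => y.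
  rewrite lerBlDr (le_trans (dom_le _ (y + y')))//.
  rewrite (linearD N) (linearD j) toRD opprD [x + x' + _]addrACA [leRHS]addrACA lerD2l.
  by rewrite -mulrDr ler_wpM2l.
rewrite -ler_pdivrMl//; apply: le_dom => y.
rewrite ler_pdivrMl// (le_trans (dom_le _ (ofR r *: y)))//.
rewrite (linearZ_LR N) (linearZ_LR j) -scalerBr nXZ//.
by rewrite [ofR r *: _]/(ofR r * _) toRZ mulrDr mulrCA.
Qed.

Lemma hahn_banach : exists phi : dual X,
  (forall x, `|phi x| <= ofR C * `|x|) /\ (forall y, phi (j y) = N y).
Proof.
have [f [fp fD fZ]] := real_functional dom_sublinear.
have fn x : f x <= C * nX x.
  by rewrite (le_trans (fp x))// (le_trans (dom_le x 0))// (linear0 N) (linear0 j) subr0 add0r.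
have fj y : f (j y) <= toR (N y).
  rewrite (le_trans (fp _))// (le_trans (dom_le _ y))// subrr /nX normr0.
  by rewrite mulr0 addr0.
have fN x : f (- x) = - f x by rewrite -scaleN1r -[-1]/(- ofR 1) -ofRN fZ mulN1r.
(* Both sides are odd in [y], so one inequality for all [y] gives equality. *)
have {}fj y : f (j y) = toR (N y).
  apply/eqP; rewrite eq_le fj /= -lerN2 -fN -toRN -!raddfN /=; exact: fj.
pose F (x : X) : (Cx R)^o := ofR (f x) - iu R * ofR (f (iu R *: x)).
have FD x y : F (x + y) = F x + F y.
  by rewrite /F scalerDr !fD !ofRD mulrDr opprD addrACA.
have FZ r x : F (ofR r *: x) = ofR r * F x.
  by rewrite /F scalerA (mulrC _ (ofR r)) -scalerA !fZ !ofRM mulrBr mulrCA.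
have Fi x : F (iu R *: x) = iu R * F x.
  rewrite /F scalerA iuM scaleN1r fN ofRN mulrN opprK mulrBr mulrA iuM.
  by rewrite mulN1r opprK addrC.
have FN x : F (- x) = - F x by rewrite -scaleN1r -[-1]/(- ofR 1) -ofRN FZ ofRN mulN1r.
have Fl : linear F.
  move=> a x y; rewrite FD; congr (_ + _); rewrite [a]CxE scalerBl FD FN -scalerA.
  by rewrite Fi !FZ [RHS]mulrBl mulrA.
have Fle x : `|F x| <= ofR C * `|x|.
  have [->|Fx0] := eqVneq (F x) 0; first by rewrite normr0 mulr_ge0// ofR_ge0.
  (* Rotating [x] by the unimodular [u] makes the value of [F] real and nonnegative, where the bound
     on [f] applies. *)
  pose u := `|F x| * (F x)^-1.
  have u1 : `|u| = 1 by rewrite normrM normr_id normfV mulfV ?normr_eq0.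
  have Fu : F (u *: x) = `|F x|.
    have := Fl u x 0; rewrite addr0 => ->.
    have -> : F 0 = 0 by rewrite -(scale0r 0) FZ mul0r.
    by rewrite addr0 /u; exact: mulfVK.
  have := fn (u *: x); rewrite /nX normrZ u1 mul1r.
  have -> : f (u *: x) = toR (F (u *: x)) by rewrite /F toR_CxE.
  by rewrite Fu -ofR_le ofRM !toRK.
exists (mk_bmap Fl (ex_intro _ _ Fle)); split=> // y.
by rewrite [RHS]CxE /= /F -linearZ /= !fj linearZ.
Qed.

End Extension.

Lemma norming_functional (x0 : X) :
  exists phi : dual X, (forall x, `|phi x| <= `|x|) /\ phi x0 = `|x0|.
Proof.
have jl : linear (fun c : (Cx R)^o => c *: x0).
  by move=> a b c; rewrite scalerDl scalerA.
have Nl : linear (fun c : (Cx R)^o => c * `|x0| : (Cx R)^o).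
  by move=> a b c; rewrite mulrDl -mulrA.
pose j := HB.pack_for {linear (Cx R)^o -> X} (fun c : (Cx R)^o => c *: x0)
  (GRing.isLinear.Build _ _ _ _ _ jl).
pose N := HB.pack_for {linear (Cx R)^o -> (Cx R)^o} (fun c : (Cx R)^o => c * `|x0| : (Cx R)^o)
  (GRing.isLinear.Build _ _ _ _ _ Nl).
have [|c|phi [phi1 phiE]] := @hahn_banach _ j N 1; first exact: ler01.
  by rewrite /= normrM normr_id normrZ mul1r.
exists phi; split=> [x|]; first by have := phi1 x; rewrite mul1r.
by have := phiE 1; rewrite /= scale1r mul1r.
Qed.

End HahnBanach.

(** * Completeness of sigmaWC *)

Section WeakStarLimits.
Variables (R : realType) (E : normedModType (Cx R)) (P : predual E).

(** A norming functional for [psi] is represented by an element of the unit ball of [E]. *)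
Lemma pre_norm_le (psi : P) (k : Cx R) : 0 <= k ->
  (forall x, `|pairing P x psi| <= k * `|x|) -> `|psi| <= k.
Proof.
move=> k0 kP; have [phi [phi1 phipsi]] := norming_functional psi.
rewrite -[leLHS]normr_id -phipsi -of_dualK (le_trans (kP _))//.
rewrite ler_piMr// -(pre_isometry P) (projT2 (cid (pre_surj phi))).
by apply: opnorm_le => // x; rewrite mul1r.
Qed.

(** The predual is norm closed in the dual of [E], being complete and, by [pre_norm_le],
    isometrically embedded there. *)
Lemma wstar_norm_limit (f : E -> Cx R) :
  (forall e : Cx R, 0 < e ->
     exists psi, forall x, `|f x - pairing P x psi| <= e * `|x|) ->
  exists psi, forall x, f x = pairing P x psi.
Proof.
move=> fP.
pose S (r : R) := [set psi : P | forall x, `|f x - pairing P x psi| <= ofR r * `|x|].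
have S0 r : 0 < r -> S r !=set0 by move=> r0; apply: fP; rewrite ltcR.
have Sle r s : r <= s -> S r `<=` S s.
  move=> rs psi h x; apply: (le_trans (h x)).
  by rewrite ler_wpM2r// ofR_le.
pose G := filter_from [set r : R | 0 < r] S.
have PG : ProperFilter G.
  apply: filter_from_proper => [|r /= r0]; last exact: S0.
  apply: filter_from_filter => [|r s /= r0 s0]; first by exists 1 => /=.
  exists (Num.min r s); first by rewrite /= lt_min r0.
  by move=> psi h; split; apply: Sle h; rewrite ge_min lexx ?orbT.
have dist r psi psi' : 0 < r -> S r psi -> S r psi' -> `|psi - psi'| <= ofR (r + r).
  move=> r0 h h'; apply: pre_norm_le => [|x]; first by rewrite ofR_ge0 ltW// addr_gt0.
  have -> : pairing P x (psi - psi') = (f x - pairing P x psi') - (f x - pairing P x psi).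
    rewrite /pairing (linearB (pre_iso P x)) opprB [RHS]addrC.
    by rewrite addrA subrK.
  by rewrite (le_trans (ler_normB _ _))// ofRD mulrDl lerD.
have /cvg_ex[psi Gpsi] : cvg G.
  apply: cauchy_cvg; apply: cauchy_exP => e e0.
  (* Two elements of [S r] are at distance at most [r + r], which stays strictly below [e] for a
     third of [e]. *)
  have r0 : 0 < toR e / 3 by rewrite divr_gt0// (toR_lt e0).
  have [psi hpsi] := S0 _ r0; exists psi; exists (toR e / 3) => // psi' h'.
  rewrite -ball_normE /= (le_lt_trans (dist _ _ _ r0 hpsi h'))//.
  rewrite -[ltRHS](toRK (ltW e0)) ltcR -mulrDl ltr_pdivrMr//.
  by rewrite (natrD _ 2 1) mulrDr mulr_natr mulr2n mulr1 ltrDl (toR_lt e0).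
exists psi => x; apply/eqP; rewrite -subr_eq0 -normr_le0; apply/ler_addgt0Pr => e e0.
rewrite add0r.
(* Multiplied by the norm of [x], this radius is at most half of [e]; the added 1 covers [x = 0]. *)
have r0 : 0 < toR e / 2 / (toR `|x| + 1).
  by rewrite !divr_gt0// ?(toR_lt e0)// ltr_wpDl// (toR_le (normr_ge0 x)).
have /cvgrPdist_le/(_ (ofR (toR e / 2 / (toR `|x| + 1)))) : id @ G --> psi by [].
rewrite ltcR => /(_ r0) Hpsi.
have /filterI/(_ Hpsi) /filter_ex[psi' []] : G (S (toR e / 2 / (toR `|x| + 1))).
  by exists (toR e / 2 / (toR `|x| + 1)).
move=> /(_ x) h1 /= h2.
have xle : ofR (toR e / 2 / (toR `|x| + 1)) * `|x| <= ofR (toR e / 2).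
  rewrite -{2}[`|x|]toRK// -ofRM ofR_le -mulrA ler_piMr//.
    by rewrite divr_ge0// (toR_le (ltW e0)).
  rewrite mulrC ler_pdivrMr ?mul1r ?lerDl//.
  by rewrite ltr_wpDl// (toR_le (normr_ge0 x)).
rewrite -(subrKA (pairing P x psi')) (le_trans (ler_normD _ _))//.
rewrite -[e](toRK (ltW e0)) [toR e]splitr ofRD lerD//.
  exact: le_trans xle.
rewrite -(linearB (pre_iso P x)) (le_trans (pairing_le _ _))// distrC mulrC.
by apply: le_trans xle; rewrite ler_wpM2r.
Qed.

End WeakStarLimits.

Section SigmaWCCompleteness.
Variables (R : realType) (A : dualBanachAlg R) (E : normedModType (Cx R)).
Hypothesis E_complete : forall F : set_system E,
  ProperFilter F -> cauchy F -> cvg F.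
Variable M : bimodule A E.
Let P := dba_pre A.

(** For each approximant [y] the functional [a |-> W (act a y)] lies in the predual of [A], and
    these converge in norm to the one for [x]. Both actions are instances of [act]. *)
Let limit_continuous (act : A -> E -> E) (k : Cx R) (x : E) (W : dual E) :
  0 <= k -> bilinear_map act -> (forall a y, `|act a y| <= k * `|a| * `|y|) ->
  (forall e : Cx R, 0 < e -> exists y, `|x - y| < e /\
     continuous (fun a : sigma (pairing P) => W (act a y) : (Cx R)^o)) ->
  continuous (fun a : sigma (pairing P) => W (act a x) : (Cx R)^o).
Proof.
move=> k0 bil actk xlim.
have [|psi psiE] := @wstar_norm_limit R A P (fun a => W (act a x)).
  move=> e e0; pose m := opnorm W * k + 1.
  have m0 : 0 < m by rewrite ltr_wpDl// mulr_ge0 ?opnorm_ge0.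
  have [|y [xy yc]] := xlim (e / m); first by rewrite divr_gt0.
  have yl : linear (fun a : A => W (act a y) : (Cx R)^o).
    by move=> c a b; rewrite bil.1 (bmap_linear W).
  have [psi psiE] := wstar_functional yl yc; exists psi => a.
  rewrite -psiE -(linearB W).
  have -> : act a x - act a y = act a (x - y).
    by rewrite addrC -scaleN1r -(bil.2 a) scaleN1r addrC.
  rewrite (le_trans (le_opnorm _ _))//.
  rewrite (le_trans (ler_wpM2l (opnorm_ge0 W) (actk _ _)))//.
  rewrite (mulrAC k) !mulrA ler_wpM2r//.
  rewrite (@le_trans _ _ (m * (e / m)))//; last first.
    by rewrite mulrC divfK ?gt_eqF.
  rewrite ler_pM ?mulr_ge0 ?opnorm_ge0//; last exact: ltW.
  by rewrite lerDl.
rewrite (_ : (fun a : sigma (pairing P) => _) = (fun a => pairing P a psi)).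
  exact: (@sigma_evalc _ _ _ (pairing P) psi).
by apply/funext.
Qed.

Lemma sigmaWC_complete (F : set_system (sigmaWC M)) :
  ProperFilter F -> cauchy F -> cvg F.
Proof.
move=> PF /cauchyP Fc.
have /cvg_ex[x Fx] : cvg ((val : sigmaWC M -> E) @ F).
  apply: E_complete; apply: cauchy_exP => e /Fc[w Fw]; exists (val w).
  by move: Fw; apply: (@filterS _ F) => w'; rewrite -!ball_normE.
have near_x (e : Cx R) : 0 < e -> exists w : sigmaWC M, `|x - val w| < e.
  move=> e0; have /cvgrPdist_lt/(_ _ e0) /filter_ex[w xw] := Fx.
  by exists w.
have xWC : x \in in_sigmaWC M.
  have [k k0 kP] := act_bounded M.
  apply/in_sigmaWCP; split=> W.
    apply: (@limit_continuous (lact M) k) => //; first exact: lact_bilinear.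
      by move=> a y; have [] := kP a y.
    move=> e /near_x[w xw]; exists (val w); split=> //.
    by have /in_sigmaWCP[+ _] := valP w; apply.
  apply: (@limit_continuous (fun a x => ract M x a) k) => //.
  - by split=> [y|a]; [exact: (ract_bilinear M).2|exact: (ract_bilinear M).1].
  - by move=> a y; have [_] := kP a y; rewrite mulrAC.
  - move=> e /near_x[w xw]; exists (val w); split=> //.
    by have /in_sigmaWCP[_ +] := valP w; apply.
apply/cvg_ex; exists (SigmaWC xWC); apply/cvgrPdist_le => e e0.
by have /cvgrPdist_le/(_ _ e0) := Fx.
Qed.

End SigmaWCCompleteness.

(** * From a virtual diagonal to Connes-amenability *)

Section Pairing.
Variables (R : realType) (E : normedModType (Cx R)) (P : predual E).

Lemma pairing_inj (x y : E) : (forall psi, pairing P x psi = pairing P y psi) -> x = y.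
Proof.
move=> xy; apply/subr0_eq/normr0_eq0; rewrite -(pre_isometry P).
have -> : pre_iso P (x - y) = 0; last exact: normr0.
apply: bmap_ext => psi; rewrite -[LHS]/(pairing P (x - y) psi).
by rewrite addrC -scaleN1r pairingDl xy mulN1r addNr.
Qed.

Lemma pairing_sigma_continuous (X : topologicalType) (f : X -> E) psi :
  continuous (f : X -> sigma (pairing P)) ->
  continuous (fun x => pairing P (f x) psi : (Cx R)^o).
Proof.
move=> fc x; apply: (@continuous_comp _ _ _ (f : X -> sigma (pairing P))
  (fun z => pairing P z psi : (Cx R)^o)); first exact: fc.
exact: (@sigma_evalc _ _ _ (pairing P) psi).
Qed.

(** Weak*-continuous functionals come from the predual; the preadjoint is given one vector at a
    time. *)
Lemma preadjoint (F : normedModType (Cx R)) (Q : predual F) (f : F -> E) :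
  linear f -> sigma_continuous (pairing Q) (pairing P) f ->
  forall psi, exists psi', forall x, pairing P (f x) psi = pairing Q x psi'.
Proof.
move=> fl fc psi.
apply: (@wstar_functional _ _ Q (fun x => pairing P (f x) psi)).
  by move=> a x y; rewrite fl pairingDl.
exact: pairing_sigma_continuous.
Qed.

End Pairing.

Section TensorDual.
Variables (R : realType) (E F : normedModType (Cx R)) (T : projTensor E F).

Lemma dual_tensor_ext (g h : dual T) :
  (forall x y, g (pt_tensor T x y) = h (pt_tensor T x y)) -> g = h.
Proof. exact: (@pt_ext _ _ _ T (Cx_complete_normed R)). Qed.

End TensorDual.

(** * The multiplication map as a bimodule map *)

Section DeltaSigmaWC.
Variables (R : realType) (A : dualBanachAlg R) (T : projTensor A A).
Let P := dba_pre A.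
Let TM := dual_bimodule (tensor_bimodule T).
Let W := sigmaWC_bimodule TM.
Implicit Type M : dual (sigmaWC TM).

Lemma pairing_Delta_sigmaWC M psi :
  pairing P (Delta_sigmaWC M) psi = M (Delta_pre T psi).
Proof. exact: of_dualK. Qed.

Lemma Delta_preE (psi : P) a b :
  (val (Delta_pre T psi) : dual T) (pt_tensor T a b) = pairing P (ba_mul a b) psi.
Proof. by rewrite /= DeltaE. Qed.

(** On elementary tensors, [Delta_pre] intertwines the preadjoint of left multiplication by [a] with
    the right action of [a]. *)
Lemma Delta_sigmaWC_lact a M :
  Delta_sigmaWC (lact (dual_bimodule W) a M) = ba_mul a (Delta_sigmaWC M).
Proof.
apply: pairing_inj => psi.
have [psi' psiE] := preadjoint ((ba_bilinear A).2 a) (@dba_mul_wcontl _ A a) psi.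
rewrite psiE !pairing_Delta_sigmaWC; congr (M _); apply/val_inj/dual_tensor_ext => b c.
by rewrite Delta_preE -psiE /= tensor_lactE DeltaE ba_assoc.
Qed.

Lemma Delta_sigmaWC_ract M a :
  Delta_sigmaWC (ract (dual_bimodule W) M a) = ba_mul (Delta_sigmaWC M) a.
Proof.
apply: pairing_inj => psi.
have [psi' psiE] := preadjoint ((ba_bilinear A).1 a) (@dba_mul_wcontr _ A a) psi.
rewrite psiE !pairing_Delta_sigmaWC; congr (M _); apply/val_inj/dual_tensor_ext => b c.
by rewrite Delta_preE -psiE /= tensor_ractE DeltaE ba_assoc.
Qed.

End DeltaSigmaWC.

(** * The functionals [theta] and the implementing element *)

Section DiagonalToAmenable.
Variables (R : realType) (A : dualBanachAlg R) (T : projTensor A A).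
Let P := dba_pre A.
Let TM := dual_bimodule (tensor_bimodule T).
Variables (E : normedModType (Cx R)) (PE : predual E) (N : bimodule A E).
Hypotheses (Nd : dual_module PE N) (Nn : normal_module PE N).
Variable D : bmap A E.
Hypotheses (Dd : derivation N D).
Hypothesis (Dc : sigma_continuous (pairing P) (pairing PE) D).

Let theta_bilinear (x : PE) :
  bilinear_map (fun a b : A => pairing PE (lact N a (D b)) x : Cx_complete_normed R).
Proof.
split=> [b c a a'|a c b b'].
  by rewrite (lact_bilinear N).1 pairingDl.
by rewrite (bmap_linear D) (lact_bilinear N).2 pairingDl.
Qed.

Let theta_bound : exists2 k : Cx R, 0 <= k & forall x (a b : A),
  `|pairing PE (lact N a (D b)) x| <= k * `|x| * `|a| * `|b|.
Proof.
have [k k0 kP] := act_bounded N.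
exists (k * opnorm D) => [|x a b]; first by rewrite mulr_ge0 ?opnorm_ge0.
rewrite (le_trans (pairing_le _ _))//.
rewrite (le_trans (ler_wpM2r (normr_ge0 x) (kP a (D b)).1))//.
rewrite (le_trans (ler_wpM2r (normr_ge0 x)
  (ler_wpM2l (mulr_ge0 k0 (normr_ge0 a)) (le_opnorm D b))))//.
rewrite !mulrA [leLHS]mulrAC ler_wpM2r// -!mulrA ler_wpM2l//.
by rewrite mulrCA (mulrC `|x|).
Qed.

Let K : Cx R := s2val (cid2 theta_bound).
Let K0 : 0 <= K := s2valP (cid2 theta_bound).
Let KP x (a b : A) : `|pairing PE (lact N a (D b)) x| <= K * `|x| * `|a| * `|b|.
Proof. exact: (s2valP' (cid2 theta_bound)). Qed.

Let theta (x : PE) : dual T :=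
  pt_lift T (theta_bilinear x) (mulr_ge0 K0 (normr_ge0 x)) (KP x).

Let thetaE x a b : theta x (pt_tensor T a b) = pairing PE (lact N a (D b)) x.
Proof.
exact: (pt_liftE T (theta_bilinear x) (mulr_ge0 K0 (normr_ge0 x)) (KP x) a b).
Qed.

Let theta_linear : linear theta.
Proof.
move=> c x y; apply: dual_tensor_ext => a b.
by rewrite bmapD bmapZ !thetaE pairingDr.
Qed.

Let theta_le x : `|theta x| <= K * `|x|.
Proof. exact: (pt_lift_le T (theta_bilinear x) (mulr_ge0 K0 (normr_ge0 x)) (KP x)). Qed.

Let theta_bounded : exists k : Cx R, forall x, `|theta x| <= k * `|x|.
Proof. by exists K. Qed.

Let thetab : bmap PE (dual T) := mk_bmap theta_linear theta_bounded.

Let theta_ract a x x' : (forall z, pairing PE (lact N a z) x = pairing PE z x') ->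
  ract TM (theta x) a = theta x'.
Proof.
move=> h; apply: dual_tensor_ext => b c.
by rewrite thetaE /= tensor_lactE thetaE -lactA h.
Qed.

(** The derivation rule splits [b . D (c a)] into [(b . D c) . a], which yields [theta x'], and
    [(b c) . D a], which yields [psi] pulled back along [Delta]. *)
Let theta_lact a x x' psi :
  (forall z, pairing PE (ract N z a) x = pairing PE z x') ->
  (forall b, pairing PE (lact N b (D a)) x = pairing P b psi) ->
  lact TM a (theta x) = theta x' + adjoint (Delta T) (pre_embed P psi).
Proof.
move=> h g; apply: dual_tensor_ext => b c.
rewrite bmapD thetaE /= tensor_ractE thetaE DeltaE -[X in _ + X]/(pairing P (ba_mul b c) psi).
rewrite -h -g Dd; have -> : lact N b (lact N c (D a) + ract N (D c) a) =
   1 *: ract N (lact N b (D c)) a + lact N (ba_mul b c) (D a).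
  by rewrite -(scale1r (lact N c _)) (lact_bilinear N).2 !scale1r lractA lactA addrC.
by rewrite pairingDl mul1r.
Qed.

Let pre_lact a x : exists x', forall z, pairing PE (lact N a z) x = pairing PE z x'.
Proof. by apply: preadjoint; [exact: (lact_bilinear N).2|exact: (Nd a).1]. Qed.

Let pre_ract a x : exists x', forall z, pairing PE (ract N z a) x = pairing PE z x'.
Proof. by apply: preadjoint; [exact: (ract_bilinear N).1|exact: (Nd a).2]. Qed.

Let pre_orbit z x : exists psi, forall b, pairing PE (lact N b z) x = pairing P b psi.
Proof. by apply: preadjoint; [exact: (lact_bilinear N).1|exact: (Nn z).1]. Qed.

Let theta_sigmaWC x : theta x \in in_sigmaWC TM.
Proof.
(* With [v] and [w] representing [V] on the functionals [theta] and on the image of the predual of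
   [A], the orbit maps become [<v . a, x> + <w . D a, x>] and [<a . v, x>], continuous by normality
   and by continuity of [D]. *)
apply/in_sigmaWCP; split=> V; pose v : E := of_dual (bmap_comp V thetab).
  pose w : A := of_dual (bmap_comp V (bmap_comp (adjoint (Delta T)) (pre_embed P))).
  rewrite (_ : (fun a => _) = (fun a => 1 *: pairing PE (ract N v a) x +
      pairing PE (lact N w (D a)) x : (Cx R)^o)); last first.
    apply/funext => a.
    have [[x' x'E] [psi psiE]] := (pre_ract a x, pre_orbit (D a) x).
    rewrite (theta_lact x'E psiE) linearD x'E psiE scale1r.
    by rewrite /v /w !of_dualK.
  apply: continuous_lin; apply: pairing_sigma_continuous; first exact: (Nn v).2.
  move=> a; apply: (@continuous_comp _ _ _ (D : sigma (pairing P) -> sigma (pairing PE))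
    (lact N w : _ -> sigma (pairing PE))); first exact: Dc.
  exact: (Nd w).1.
rewrite (_ : (fun a => _) = (fun a => pairing PE (lact N a v) x)).
  by apply: pairing_sigma_continuous; exact: (Nn v).1.
apply/funext => a; have [x' x'E] := pre_lact a x.
by rewrite (theta_ract x'E) x'E /v of_dualK.
Qed.

Lemma diagonal_inner (M : dual (sigmaWC TM)) : sigmaWC_virtual_diagonal M -> inner N D.
Proof.
move=> [Mcomm aDM]; set e := Delta_sigmaWC M in aDM.
(* The right identity [e] is also a left one, because [M] commutes with [a] and [Delta_sigmaWC]
   respects both actions. *)
have eDa a : ba_mul e a = a.
  by rewrite /e -Delta_sigmaWC_ract -Mcomm Delta_sigmaWC_lact aDM.
have yl : linear (fun x => M (SigmaWC (theta_sigmaWC x)) : (Cx R)^o).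
  move=> c x x'; rewrite -(bmap_linear M); congr (M _); apply: val_inj.
  exact: theta_linear.
have yb : exists k : Cx R, forall x, `|M (SigmaWC (theta_sigmaWC x))| <= k * `|x|.
  exists (opnorm M * K) => x; rewrite (le_trans (le_opnorm M _))// -mulrA.
  by rewrite ler_wpM2l ?opnorm_ge0//; exact: theta_le.
pose y : E := of_dual (mk_bmap yl yb).
(* Commutation of [M] cancels the [theta] terms; the correction [Delta_pre T psi] contributes
   [<e, psi> = <e . D a, x>]. *)
have yE a : lact N a y - ract N y a = lact N e (D a).
  apply: (@pairing_inj _ _ PE) => x.
  have [[xa xaE] [ax axE]] := (pre_lact a x, pre_ract a x).
  have [psi psiE] := pre_orbit (D a) x.
  rewrite addrC -scaleN1r pairingDl mulN1r xaE axE psiE.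
  rewrite pairing_Delta_sigmaWC /y !of_dualK /=.
  have -> : SigmaWC (theta_sigmaWC xa) =
      ract (sigmaWC_bimodule TM) (SigmaWC (theta_sigmaWC x)) a.
    by apply/val_inj; rewrite /= -(theta_ract xaE).
  have -> : SigmaWC (theta_sigmaWC ax) =
      lact (sigmaWC_bimodule TM) a (SigmaWC (theta_sigmaWC x)) - Delta_pre T psi.
    apply/val_inj; rewrite -[RHS]/(lact TM a (theta x) -
      adjoint (Delta T) (pre_embed P psi)).
    by rewrite (theta_lact axE psiE) addrK.
  have := congr1 (fun L : dual _ => L (SigmaWC (theta_sigmaWC x))) (Mcomm a).
  rewrite /= => ->; rewrite linearB opprB subrK //.
(* Multiply [D e = e . D e + D e . e] by [a] on the left. *)
have aDee a : lact N a (ract N (D e) e) = 0.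
  have := congr1 (lact N a) (Dd e e); rewrite aDM.
  rewrite -(scale1r (lact N e _)) (lact_bilinear N).2 scale1r lactA aDM.
  by move/eqP; rewrite eq_sym -subr_eq0 addrAC subrr add0r => /eqP.
(* The correction adds [D e . a] to [e . D a], and the sum is [D (e a) = D a]. *)
exists (y - ract N (D e) e) => a.
rewrite -[lact N a _]/(lactb N a _) -[ract N _ a]/(ractb N a _) !linearB /=.
by rewrite aDee subr0 opprK addrA ractA eDa yE -Dd eDa.
Qed.

End DiagonalToAmenable.

(** * From Connes-amenability to a virtual diagonal *)

Section DualOfComplete.
Variables (R : realType) (X : completeNormedModType (Cx R)).

Let id_linear : linear (id : dual X -> dual X).
Proof. by []. Qed.

Let id_surj (phi : dual X) : exists psi : dual X, psi = phi.
Proof. by exists phi. Qed.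

Definition dual_predual : predual (dual_complete_normed X) :=
  @Predual R (dual_complete_normed X) X id id_linear (fun=> erefl) id_surj.

Lemma dual_dual_module (A : dualBanachAlg R) (M : bimodule A X) :
  @dual_module R A (dual_complete_normed X) dual_predual (dual_bimodule M).
Proof.
move=> a; split; apply: continuous_sigma => x.
  exact: (@sigma_evalc _ _ _ (pairing dual_predual) (ract M x a)).
exact: (@sigma_evalc _ _ _ (pairing dual_predual) (lact M a x)).
Qed.

End DualOfComplete.

Section CompressedBimodule.
Variables (R : realType) (A : banachAlg R) (E : normedModType (Cx R)).
Variables (M : bimodule A E) (p : bmap E E).
(** For an idempotent [p], this and [pr] say that the kernel of [p] is a submodule. *)
Hypothesis pl : forall a x, p (lact M a (p x)) = p (lact M a x).
Hypothesis pr : forall x a, p (ract M (p x) a) = p (ract M x a).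

Let clact a x := p (lact M a x).
Let cract x a := p (ract M x a).

Let clact_bilinear : bilinear_map clact.
Proof.
split=> [x c a b|a c x y]; rewrite /clact.
  by rewrite (lact_bilinear M).1 bmap_linear.
by rewrite (lact_bilinear M).2 bmap_linear.
Qed.

Let cract_bilinear : bilinear_map cract.
Proof.
split=> [a c x y|x c a b]; rewrite /cract.
  by rewrite (ract_bilinear M).1 bmap_linear.
by rewrite (ract_bilinear M).2 bmap_linear.
Qed.

Let clactA a b x : clact a (clact b x) = clact (ba_mul a b) x.
Proof. by rewrite /clact pl lactA. Qed.

Let cractA x a b : cract (cract x a) b = cract x (ba_mul a b).
Proof. by rewrite /cract pr ractA. Qed.

Let clractA a x b : cract (clact a x) b = clact a (cract x b).
Proof. by rewrite /cract /clact pr pl lractA. Qed.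

Let cact_bounded : exists2 k : Cx R, 0 <= k & forall a x,
  `|clact a x| <= k * `|a| * `|x| /\ `|cract x a| <= k * `|x| * `|a|.
Proof.
have [k k0 kP] := act_bounded M; exists (opnorm p * k) => [|a x].
  by rewrite mulr_ge0 ?opnorm_ge0.
split; apply: (le_trans (le_opnorm p _)); rewrite -!mulrA ler_wpM2l ?opnorm_ge0// mulrA.
  exact: (kP a x).1.
exact: (kP a x).2.
Qed.

(* When [p] is idempotent and its kernel is a submodule, this is the direct sum
   of the quotient of [M] by that kernel and of the kernel with zero actions. *)
Definition compressed_bimodule : bimodule A E :=
  Bimodule clact_bilinear cract_bilinear clactA cractA clractA cact_bounded.

End CompressedBimodule.

Section OneSidedModules.
Variables (R : realType) (A : dualBanachAlg R).
Let P := dba_pre A.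

Let zero_bilinear (U V : normedModType (Cx R)) : bilinear_map (fun (_ : U) (_ : V) => 0 : A).
Proof. by split=> [v c x y|u c x y]; rewrite scaler0 addr0. Qed.

Let zero_bounded (x y : A) (k : Cx R) : 0 <= k -> `|0 : A| <= k * `|x| * `|y|.
Proof. by move=> k0; rewrite normr0 !mulr_ge0. Qed.

Let mulb0 (a : A) : 0 = ba_mul a 0.
Proof. exact: (esym (linear0 (lactb (regular_bimodule A) a))). Qed.

Let mul0b (a : A) : ba_mul 0 a = 0.
Proof. exact: (linear0 (ractb (regular_bimodule A) a)). Qed.

Let left_bounded : exists2 k : Cx R, 0 <= k & forall a x : A,
  `|ba_mul a x| <= k * `|a| * `|x| /\ `|0 : A| <= k * `|x| * `|a|.
Proof. by exists 1 => // a x; rewrite zero_bounded// mul1r ba_norm. Qed.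

Let right_bounded : exists2 k : Cx R, 0 <= k & forall a x : A,
  `|0 : A| <= k * `|a| * `|x| /\ `|ba_mul x a| <= k * `|x| * `|a|.
Proof. by exists 1 => // a x; rewrite zero_bounded// mul1r ba_norm. Qed.

Let left_bimodule : bimodule A A :=
  @Bimodule R A A (@ba_mul R A) (fun _ _ => 0) (ba_bilinear A) (zero_bilinear _ _)
    (@ba_assoc _ A) (fun _ _ _ => erefl) (fun a _ _ => mulb0 a) left_bounded.

Let right_bimodule : bimodule A A :=
  @Bimodule R A A (fun _ _ => 0) (@ba_mul R A) (zero_bilinear _ _) (ba_bilinear A)
    (fun _ _ _ => erefl) (fun x a b => esym (@ba_assoc _ A x a b))
    (fun _ _ b => mul0b b) right_bounded.

Let zero_continuous : sigma_continuous (pairing P) (pairing P) (fun _ : A => 0 : A).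
Proof. exact: cst_continuous. Qed.

Let id_bounded : exists k : Cx R, forall x : A, `|x| <= k * `|x|.
Proof. by exists 1 => x; rewrite mul1r. Qed.

Let id_linear : linear (id : A -> A). Proof. by []. Qed.

Let idb : bmap A A := mk_bmap id_linear id_bounded.

Let id_continuous : sigma_continuous (pairing P) (pairing P) idb.
Proof. by move=> x; exact: cvg_id. Qed.

(* The identity map is a derivation into A with one action made trivial. *)
Lemma Connes_amenable_unit : Connes_amenable A ->
  exists e : A, forall a, ba_mul a e = a /\ ba_mul e a = a.
Proof.
move=> CA.
have [||a b|e eE] := CA A P left_bimodule _ _ idb _ id_continuous.
- by move=> a; split; [exact: dba_mul_wcontl|exact: zero_continuous].
- by move=> x; split; [exact: dba_mul_wcontr|exact: zero_continuous].
- by rewrite /= addr0.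
have [||a b|f fE] := CA A P right_bimodule _ _ idb _ id_continuous.
- by move=> a; split; [exact: zero_continuous|exact: dba_mul_wcontr].
- by move=> x; split; [exact: zero_continuous|exact: dba_mul_wcontl].
- by rewrite /= add0r.
(* Innerness reads [a = a e] in the first module and [a = - f a] in the second, and a right and a
   left identity coincide. *)
have ae a : ba_mul a e = a by have := eE a; rewrite /= subr0.
have fa a : ba_mul (- f) a = a.
  have := fE a; rewrite /= sub0r.
  by rewrite -[RHS](linearN (ractb (regular_bimodule A) a)).
have fe : - f = e by rewrite -(ae (- f)) fa.
by exists e => a; split=> //; rewrite -{1}fe.
Qed.

End OneSidedModules.

(** * Construction of the virtual diagonal *)

Section AmenableToDiagonal.
Variables (R : realType) (A : dualBanachAlg R) (T : projTensor A A).
Let P := dba_pre A.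
Let TM := dual_bimodule (tensor_bimodule T).
Let W := sigmaWC TM.
Let WM := sigmaWC_bimodule TM.
Hypothesis CA : Connes_amenable A.
Variable e : A.
Hypotheses (ae : forall a, ba_mul a e = a) (ea : forall a, ba_mul e a = a).

Let Wc : completeNormedModType (Cx R) :=
  HB.pack (sigmaWC TM) (Uniform_isComplete.Build (sigmaWC TM)
    (sigmaWC_complete (@bmap_complete R T (Cx_complete_normed R)) (M := TM))).

Let eval_linear (t : T) : linear (fun w : W => val w t : (Cx R)^o).
Proof. by move=> c w w'; rewrite linearP bmapD bmapZ. Qed.

Let eval_bounded (t : T) : exists k : Cx R, forall w : W, `|val w t : (Cx R)^o| <= k * `|w|.
Proof. by exists `|t| => w; rewrite mulrC; exact: le_opnorm. Qed.

Let eval (t : T) : dual W := mk_bmap (eval_linear t) (eval_bounded t).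

Let eval2_linear (t : T) : linear (fun w : dual T => w t : (Cx R)^o).
Proof. by move=> c w w'. Qed.

Let eval2_bounded (t : T) : exists k : Cx R, forall w : dual T, `|w t| <= k * `|w|.
Proof. by exists `|t| => w; rewrite mulrC; exact: le_opnorm. Qed.

Let eval2 (t : T) : dual (dual T) := mk_bmap (eval2_linear t) (eval2_bounded t).

Let tens_linear_l : linear (fun a : A => pt_tensor T a e).
Proof. exact: (pt_bilinear T).1. Qed.

Let tens_bounded_l : exists k : Cx R, forall a : A, `|pt_tensor T a e| <= k * `|a|.
Proof. by exists `|e| => a; rewrite mulrC; exact: pt_norm. Qed.

Let tens_l : bmap A T := mk_bmap tens_linear_l tens_bounded_l.

Let q : bmap T T := bmap_comp tens_l (Delta T).

Let qE a b : q (pt_tensor T a b) = pt_tensor T (ba_mul a b) e.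
Proof. by rewrite /= DeltaE. Qed.

Let sigmaWC_cont_r (w : W) (V : dual (dual T)) :
  continuous (fun a : sigma (pairing P) => V (ract TM (val w) a) : (Cx R)^o).
Proof. by have /in_sigmaWCP[_] := valP w; apply. Qed.

Let sigmaWC_cont_l (w : W) (V : dual (dual T)) :
  continuous (fun a : sigma (pairing P) => V (lact TM a (val w)) : (Cx R)^o).
Proof. by have /in_sigmaWCP[+ _] := valP w; apply. Qed.

(** Since [a (x) e = a . (e (x) e)], the functional [a |-> w (a (x) e)] is weak*-continuous, so it
    is some [psi] in the predual, and the subtracted term is its image under the adjoint of
    [Delta]. *)
Let proj_sigmaWC (w : W) : val w - adjoint q (val w) \in in_sigmaWC TM.
Proof.
have [|psi psiE] := @wstar_functional _ _ P (bmap_comp (val w) tens_l) (bmap_linear _).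
  rewrite (_ : (bmap_comp (val w) tens_l : A -> (Cx R)^o) =
      (fun a => eval2 (pt_tensor T e e) (ract TM (val w) a))).
    exact: sigmaWC_cont_r.
  by apply/funext => a; rewrite /= tensor_lactE ae.
have -> : adjoint q (val w) = adjoint (Delta T) (pre_embed P psi).
  by apply: bmap_ext => t; exact: psiE.
by apply: rpredB; [exact: valP|exact: Delta_adjoint_sigmaWC].
Qed.

Let proj (w : W) : W := SigmaWC (proj_sigmaWC w).

Let val_proj (w : W) : val (proj w) = val w - adjoint q (val w).
Proof. by []. Qed.

Let val_linear : linear (val : W -> dual T).
Proof. exact: linearP. Qed.

Let proj_linear : linear proj.
Proof.
move=> c w w'; apply: val_inj; rewrite [RHS]val_linear !val_proj val_linear.
by rewrite bmap_linear opprD addrACA -scalerBr.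
Qed.

Let proj_bounded : exists k : Cx R, forall w, `|proj w| <= k * `|w|.
Proof.
have [k kP] := bmap_bounded (adjoint q); exists (1 + k) => w.
by rewrite mulrDl mul1r; apply: le_trans (ler_normB _ _) _; rewrite lerD2l.
Qed.

Let projb : bmap W W := mk_bmap proj_linear proj_bounded.

Let projE (w : W) t : val (projb w) t = val w t - val w (q t).
Proof. by []. Qed.

Let sigmaWC_ext (w w' : W) :
  (forall a b, val w (pt_tensor T a b) = val w' (pt_tensor T a b)) -> w = w'.
Proof. by move=> ww'; apply/val_inj/dual_tensor_ext. Qed.

(** The values of [w] at [(b c a) (x) e] cancel. *)
Let proj_lact a w : projb (lact WM a (projb w)) = projb (lact WM a w).
Proof.
apply: sigmaWC_ext => b c; rewrite !projE qE /= !tensor_ractE.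
rewrite -[X in X - _]/(val w (pt_tensor T b (ba_mul c a)) - val w (q (pt_tensor T b (ba_mul c a)))).
rewrite -[X in _ - X = _]/(val w (pt_tensor T (ba_mul b c) (ba_mul e a)) -
  val w (q (pt_tensor T (ba_mul b c) (ba_mul e a)))).
by rewrite !qE ea ba_assoc opprB addrA subrK.
Qed.

Let proj_ract w a : projb (ract WM (projb w) a) = projb (ract WM w a).
Proof.
apply: sigmaWC_ext => b c; rewrite !projE qE /= !tensor_lactE.
rewrite -[X in X - _]/(val w (pt_tensor T (ba_mul a b) c) - val w (q (pt_tensor T (ba_mul a b) c))).
rewrite -[X in _ - X = _]/(val w (pt_tensor T (ba_mul a (ba_mul b c)) e) -
  val w (q (pt_tensor T (ba_mul a (ba_mul b c)) e))).
by rewrite !qE ae ba_assoc opprB addrA subrK.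
Qed.

Let M := compressed_bimodule proj_lact proj_ract.

(** Membership in sigmaWC gives continuity against functionals on all of [dual T], whereas normality
    concerns functionals on [W]. *)
Let extend (V : dual W) : exists V' : dual (dual T), forall w : W, V' (val w) = V w.
Proof.
have [||V' [_ V'E]] := @hahn_banach R (dual T) W (val : {linear W -> dual T}) V (toR (opnorm V)).
- exact: (toR_le (opnorm_ge0 V)).
- by move=> w; rewrite toRK ?opnorm_ge0//; exact: le_opnorm.
by exists V'.
Qed.

Let M_normal : @normal_module R A (dual_complete_normed Wc) (dual_predual Wc) (dual_bimodule M).
Proof.
move=> V; have [V' V'E] := extend (bmap_comp V projb).
split; apply: continuous_sigma => w.
  rewrite (_ : (fun a => _) = (fun a => V' (ract TM (val w) a))).
    exact: sigmaWC_cont_r.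
  by apply/funext => a; exact: (esym (V'E (ract WM w a))).
rewrite (_ : (fun a => _) = (fun a => V' (lact TM a (val w)))).
  exact: sigmaWC_cont_l.
by apply/funext => a; exact: (esym (V'E (lact WM a w))).
Qed.

(** This is [a . u - u . a] for [u = e (x) e]: for the uncompressed actions [D] is implemented by
    evaluation at [u]. *)
Let s (a : A) : T := pt_tensor T a e - pt_tensor T e a.

Let D_linear : linear (fun a => eval (s a)).
Proof.
move=> c a b; apply: bmap_ext => w; rewrite bmapD bmapZ /= /s.
by rewrite (pt_bilinear T).1 (pt_bilinear T).2 opprD addrACA -scalerBr (bmap_linear (val w)).
Qed.

Let D_bounded : exists k : Cx R, forall a, `|eval (s a)| <= k * `|a|.
Proof.
exists (`|e| + `|e|) => a; apply: opnorm_le => [|w]; first by rewrite mulr_ge0 ?addr_ge0.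
rewrite mulrC; apply: (le_trans (le_opnorm (val w) _)); rewrite ler_wpM2l ?opnorm_ge0//.
apply: (le_trans (ler_normB _ _)); rewrite mulrDl.
by apply: lerD; [rewrite mulrC|]; exact: pt_norm.
Qed.

Let D : bmap A (dual W) := mk_bmap D_linear D_bounded.

Let D_derivation : derivation (dual_bimodule M) D.
Proof.
move=> a b; apply: bmap_ext => w; rewrite bmapD.
rewrite -[LHS]/(val w (s (ba_mul a b))).
rewrite -[RHS]/(val (projb (ract WM w a)) (s b) + val (projb (lact WM b w)) (s a)).
(* Both tensors in [s c] have product [c], so the compression is invisible at [s c]. *)
have qs c : q (s c) = 0.
  have -> : q (s c) = q (pt_tensor T c e) - q (pt_tensor T e c) by exact: linearB.
  by rewrite !qE ae ea subrr.
have proj_s w' c : val (projb w') (s c) = val w' (s c).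
  by rewrite projE qs (linear0 (val w' : dual T)) subr0.
rewrite !proj_s /= !linearB /=.
by rewrite !tensor_lactE !tensor_ractE ae ea addrA subrK.
Qed.

Let D_continuous :
  sigma_continuous (pairing P) (pairing (dual_predual Wc)) D.
Proof.
apply: continuous_sigma => w; pose V := eval2 (pt_tensor T e e).
rewrite (_ : (fun a => _) = (fun a => -1 *: V (lact TM a (val w)) +
    V (ract TM (val w) a) : (Cx R)^o)).
  by apply: continuous_lin; [exact: sigmaWC_cont_l|exact: sigmaWC_cont_r].
apply/funext => a; rewrite scaleN1r addrC /= tensor_lactE tensor_ractE ae ea.
exact: linearB.
Qed.

Lemma amenable_diagonal : exists V : dual W, sigmaWC_virtual_diagonal V.
Proof.
have [N DN] := @CA (dual_complete_normed Wc) (dual_predual Wc) (dual_bimodule M)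
  (dual_dual_module _) M_normal D D_derivation D_continuous.
(* The uncompressed actions on [bmap_comp N projb] are the compressed ones on [N], so both terms
   have the same commutator [D a] with [a]. *)
pose V : dual W := eval (pt_tensor T e e) - bmap_comp N projb.
exists V; split=> [a|a].
  apply: bmap_ext => w; have := congr1 (fun L : dual W => L w) (DN a).
  rewrite -[X in X = _]/(val w (pt_tensor T a e - pt_tensor T e a)).
  rewrite -[X in _ = X -> _]/(N (projb (ract WM w a)) - N (projb (lact WM a w))).
  rewrite linearB => /eqP; rewrite subr_eq => /eqP h.
  rewrite -[LHS]/(val w (tensor_lact T a (pt_tensor T e e)) - N (projb (ract WM w a))).
  rewrite -[RHS]/(val w (tensor_ract T a (pt_tensor T e e)) - N (projb (lact WM a w))).
  rewrite tensor_lactE tensor_ractE ae ea h.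
  by rewrite addrC !addrA addNr add0r addrC.
suff -> : Delta_sigmaWC V = e by exact: ae.
apply: (@pairing_inj _ _ P) => psi; rewrite pairing_Delta_sigmaWC.
rewrite -[LHS]/(val (Delta_pre T psi) (pt_tensor T e e) - N (projb (Delta_pre T psi))).
(* Functionals factoring through [Delta] are killed by [projb], so [N] does not affect the product
   [e] of [e (x) e]. *)
have -> : projb (Delta_pre T psi) = 0.
  apply: sigmaWC_ext => b c; rewrite projE qE !Delta_preE ae subrr //.
by rewrite linear0 subr0 Delta_preE ae.
Qed.

End AmenableToDiagonal.

(* T is any realization of the projective tensor product of A with itself. *)
Theorem theorem4p8 (R : realType) (A : dualBanachAlg R) (T : projTensor A A) :
  Connes_amenable A <->
  exists M : dual (sigmaWC (dual_bimodule (tensor_bimodule T))),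
    sigmaWC_virtual_diagonal M.
Proof.
split=> [CA|[M MD] E P N Nd Nn D Dd Dc]; last exact: diagonal_inner MD.
have [e eP] := Connes_amenable_unit CA.
by apply: (@amenable_diagonal _ _ _ CA e) => a; have [] := eP a.
Qed.
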